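(* Let $n\ge3$, let $\kappa_2(x,y)=|x-y|^{2-n}$ be the Newtonian kernel on $\mathbb R^n$, and let $$A_1=\bigcup_{k\ge2}S(x_k,r_{1,k}),\qquad A_2=\bigcup_{k\ge2}S(x_k,r_{2,k}),$$ where $x_k=(k,0,\ldots,0)$, $r_{2,k}^{2-n}=k^2$ and $r_{1,k}^{2-n}=k^2+k^{-q}$ with $q\in(0,\infty)$. Let the signs be $s_1=+1$, $s_2=-1$. Then the infimum $$\inf\ \kappa_2(\mu^1-\mu^2,\mu^1-\mu^2)$$ over all pairs $(\mu^1,\mu^2)$ of positive Radon measures of finite Newtonian energy with $\mu^i$ supported by $A_i$ and $\mu^i(A_i)=1$, $i=1,2$, equals $0$, and hence it cannot be an actual minimum (it is not attained by any such pair).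
   Context: $S(x,r)$ is the sphere $\{y\in\mathbb R^n:|y-x|=r\}$. The energy of a signed Radon measure $\nu$ is $\kappa_2(\nu,\nu)=\iint|x-y|^{2-n}\,d\nu(x)\,d\nu(y)$. The infimum is the value of the (unconstrained) minimum energy problem for the condenser $\mathbf A=(A_1,A_2)$ with zero external field, weights $g_1=g_2=1$ and total masses $a_1=a_2=1$; the energy of the vector measure $(\mu^1,\mu^2)$ is $\sum_{i,j}s_is_j\kappa_2(\mu^i,\mu^j)=\kappa_2(\mu^1-\mu^2,\mu^1-\mu^2)$. *)

(* Defs.v *)
From HB Require Import structures.
From mathcomp Require Import all_boot all_order all_algebra.
From mathcomp Require Import all_classical all_reals all_analysis.

Set Implicit Arguments.
Unset Strict Implicit.
Unset Printing Implicit Defensive.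

Import Order.TTheory GRing.Theory Num.Theory.
Import numFieldNormedType.Exports.
Local Open Scope classical_set_scope.
Local Open Scope ring_scope.

(* R^n with its Borel sigma-algebra. The library topology on 'rV[R]_n is that
   of the sup norm, which is the Euclidean topology. *)
Notation Rn R n := (g_sigma_algebraType (@open 'rV[R]_n)).

Definition borel_measure (R : realType) (n : nat) :=
  {measure set (Rn R n) -> \bar R}.

(* The library norm `|x| on 'rV[R]_n is the sup norm, hence this definition. *)
Definition enorm (R : realType) (n : nat) (x : 'rV[R]_n) : R :=
  Num.sqrt (\sum_(i < n) x ord0 i ^+ 2).

Definition sphere (R : realType) (n : nat) (x : 'rV[R]_n) (r : R) :
    set 'rV[R]_n :=
  [set y | enorm (y - x) = r].

(* |x - y|^(2-n) with an integer exponent. The value on the diagonal is +oo: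
   the algebraic convention 0^-1 = 0 would give every measure carried by a
   point zero energy. *)
Definition newton_kernel (R : realType) (n : nat) (x y : 'rV[R]_n) : \bar R :=
  if x == y then +oo%E else (enorm (x - y) ^ (2%:Z - n%:Z))%:E.

Definition mutual_energy (R : realType) (n : nat) (mu nu : borel_measure R n) :
    \bar R :=
  (\int[mu]_x \int[nu]_y newton_kernel x y)%E.

(* kappa_2(mu - nu, mu - nu), i.e. the double integral against the signed
   measure mu - nu, which is the sum over i, j of
   s_i s_j kappa_2(mu^i, mu^j) for mu^1 = mu, mu^2 = nu, s_1 = 1, s_2 = -1.
   It is meaningful when mu and nu have finite energy: kappa_2(mu, nu) is then
   finite too, so no +oo - +oo occurs. *)
Definition energy_diff (R : realType) (n : nat) (mu nu : borel_measure R n) :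
    \bar R :=
  (mutual_energy mu mu - mutual_energy mu nu
   - mutual_energy nu mu + mutual_energy nu nu)%E.

(* On R^n a Borel measure that is finite on compact sets is automatically
   regular. *)
Definition radon (R : realType) (n : nat) (mu : borel_measure R n) : Prop :=
  forall K : set 'rV[R]_n, compact K -> (mu K < +oo)%E.

Definition measure_support (R : realType) (n : nat) (mu : borel_measure R n) :
    set 'rV[R]_n :=
  [set x | forall U : set 'rV[R]_n, open U -> U x -> (0 < mu U)%E].

Definition admissible (R : realType) (n : nat) (A : set 'rV[R]_n)
    (mu : borel_measure R n) : Prop :=
  [/\ radon mu, (mutual_energy mu mu < +oo)%E,
      measure_support mu `<=` A & mu A = 1%E].

(* The point (k, 0, ..., 0). *)
Definition center (R : realType) (n k : nat) : 'rV[R]_n :=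
  \row_(i < n) (if i == 0 :> nat then k%:R else 0).

Definition sphere_union (R : realType) (n : nat) (r : nat -> R) :
    set 'rV[R]_n :=
  \bigcup_(k in [set k | (2 <= k)%N]) sphere (center R n k) (r k).

(* Main.v *)
(* Admissible measures are probabilities on R^n.  Writing |x - y|^(2-n) as a
   constant times the integral of t^(n-3) exp(-t^2 |x - y|^2) over t > 0, and
   expanding exp(2a x.y) in monomials, the energy of mu - nu becomes an integral
   over t of sums of squares of Gaussian moments of mu - nu.  Hence it is
   nonnegative, and if it vanishes then mu and nu have the same Gaussian
   potentials, and therefore give the same mass to every sphere.

   The infimum is not attained: mu^1 would give S(x_k, r_{1,k}) the mass that
   mu^2 gives to it, which is zero, because for n >= 5 the spheres of A_1 and A_2
   may meet, but only along (n-2)-dimensional spheres.  These have zero capacity: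
   about N^(n-2) pieces of diameter 1/N cover them, and the energy
   near the diagonal tends to zero.

   The infimum is zero: put on S(x_k, r_{1,k}) and S(x_k, r_{2,k}) the images of
   one probability on the unit sphere that is (n-1)-dimensional in the Frostman
   sense (Newton's theorem on the potential of the uniform measure is not
   needed).  Its Riesz energies of order below n-1 are finite, so the energy of
   the difference is at most k^(-q) e + C k^2 (1 - r_{1,k}/r_{2,k})^eta for every
   eta < 1, where 1 - r_{1,k}/r_{2,k} <= k^(-q-2). *)

Require Import Defs.
From HB Require Import structures.
From mathcomp Require Import all_boot all_order all_algebra.
From mathcomp Require Import all_classical all_reals all_analysis.
From mathcomp Require Import measurable_realfun.
From mathcomp Require Import zify ring lra.

Set Implicit Arguments.
Unset Strict Implicit.
Unset Printing Implicit Defensive.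

Import Order.TTheory GRing.Theory Num.Theory.
Import numFieldNormedType.Exports.
Local Open Scope classical_set_scope.
Local Open Scope ring_scope.

(** * Borel sets of R^n and supports *)

(** The dimension is written [m.+3], so that the kernel is the inverse of the natural power [m.+1]
    of the distance. The energy difference contains minus signs between extended reals, whereas
    Tonelli's theorem and additivity concern nonnegative integrands; the identities are therefore
    proved with every term on its positive side, and subtraction comes last, once finiteness is
    known. The monomial features of the Gaussian kernel are scaled so that their squares sum to 1:
    every function integrated against a probability is then bounded by 1, and bounded convergence
    replaces estimates of moments. The exponent eta is governed by q: k^2 times the power eta of
    k^(-q-2) tends to 0 exactly when eta > 2/(q+2). This threshold approaches 1 as q tends to 0,
    hence the demand for Riesz energies of all orders below n-1. *)

Lemma measurable_coord (R : realType) (n : nat) (i : 'I_n) :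
  measurable_fun setT (fun x : Rn R n => (x : 'rV[R]_n) ord0 i).
Proof.
apply: (measurability _ (measurable_realfun.RGenOpens.measurableE R)) => _ [_ [a [b ->]] <-].
rewrite setTI; apply: sub_sigma_algebra.
apply: open_comp; last exact: interval_open.
by move=> x _; exact: coord_continuous.
Qed.

(** A base of the topology with a countable index type. It gives measurability of maps into R^n from
    their coordinates, and nullity of the complement of a support. *)
Definition rat_box (R : realType) (n : nat) (b : 'rV[rat]_n * nat) :=
  [set x : 'rV[R]_n | forall i, `|x ord0 i - ratr (b.1 ord0 i)| < b.2.+1%:R^-1].

Lemma rat_box_base (R : realType) (n : nat) (U : set 'rV[R]_n) x :
  open U -> U x -> exists b, rat_box b x /\ rat_box b `<=` U.
Proof.
move=> oU Ux.
have /nbhs_ballP[e /= e0 eU] : nbhs x U by exact: open_nbhs_nbhs.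
have [k ke] : exists k : nat, k.+1%:R^-1 < e / 2.
  have e20 : 0 < e / 2 by rewrite divr_gt0.
  have [k _ /(_ k (leqnn _))] := near_infty_natSinv_lt (PosNum e20).
  by exists k.
have /choice[c hc] : forall i, exists c : rat, `|x ord0 i - ratr c| < k.+1%:R^-1.
  move=> i.
  have k0 : (0 : R) < k.+1%:R^-1 by rewrite invr_gt0.
  have xk : x ord0 i - k.+1%:R^-1 < x ord0 i + k.+1%:R^-1.
    by rewrite ltrD2l gt0_cp.
  have [c] := rat_in_itvoo xk.
  rewrite in_itv/= => /andP[c1 c2]; exists c.
  by move: c1 c2; move: k.+1%:R^-1 => d c1 c2; rewrite ltr_norml; apply/andP; split; lra.
exists (\row_i c i, k); split; first by move=> i; rewrite mxE.
move=> y /= hy; apply: eU; split => // i j; rewrite ord1.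
have := hy j; have := hc j; rewrite mxE /= => h1 h2.
rewrite /ball/= (_ : _ - _ = (x ord0 j - ratr (c j)) - (y ord0 j - ratr (c j)));
  last by ring.
move: h1 h2 ke; move: k.+1%:R^-1 => d h1 h2 ke.
by rewrite (le_lt_trans (ler_normB _ _))//; lra.
Qed.

Lemma measurable_preimage_rat_box d (T : measurableType d) (R : realType)
    (n : nat) (f : T -> 'rV[R]_n) (b : 'rV[rat]_n * nat) :
  (forall i, measurable_fun setT (fun t => f t ord0 i)) ->
  measurable (f @^-1` rat_box b).
Proof.
move=> mf; have -> : f @^-1` rat_box b = \bigcap_(i in [set: 'I_n])
   (fun t => `|f t ord0 i - ratr (b.1 ord0 i)|)
     @^-1` `]-oo, b.2.+1%:R^-1[.
  apply/seteqP; split => [t /= h i _ /=|t /= h i]; first by rewrite in_itv/=.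
  by have := h i I; rewrite /= in_itv.
apply: fin_bigcap_measurable => // i _; rewrite -[X in measurable X]setTI.
have := measurable_funB (mf i) (@measurable_cst _ _ _ _ setT (ratr (b.1 ord0 i) : R)).
move=> /(measurableT_comp (@normr_measurable _ setT)); apply => //.
Qed.

(** The sigma-algebra is generated by the open sets rather than by the coordinates; the two agree
    because an open set is a countable union of rational boxes. *)
Lemma measurable_rV d (T : measurableType d) (R : realType) (n : nat)
    (f : T -> Rn R n) :
  (forall i, measurable_fun setT (fun t => (f t : 'rV[R]_n) ord0 i)) ->
  measurable_fun setT f.
Proof.
move=> mf.
apply: (@measurability _ _ T (Rn R n) setT f (@open 'rV[R]_n)) => //.
move=> _ [U oU <-].
rewrite setTI.
have -> : f @^-1` U = \bigcup_(b : 'rV[rat]_n * nat)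
    (if `[< rat_box b `<=` U >] then f @^-1` rat_box b else set0).
  apply/seteqP; split => [t /= Ut|t [b _]].
    have [b [bt bU]] := @rat_box_base _ _ _ (f t) oU Ut.
    by exists b => //; case: asboolP.
  by case: asboolP => // bU; exact: bU.
apply: countable_bigcupT_measurable; first exact: countableP.
by move=> b; case: ifP => // _; exact: measurable_preimage_rat_box.
Qed.

Lemma measurable_rat_box (R : realType) (n : nat) (b : 'rV[rat]_n * nat) :
  measurable (rat_box b : set (Rn R n)).
Proof.
have := @measurable_preimage_rat_box _ (Rn R n) R n id b.
by apply; exact: measurable_coord.
Qed.

Lemma open_Rn_measurable (R : realType) (n : nat) (U : set 'rV[R]_n) :
  open U -> measurable (U : set (Rn R n)).
Proof. exact: sub_sigma_algebra. Qed.

Lemma open_setC_support (R : realType) (n : nat) (mu : borel_measure R n) :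
  open (~` measure_support mu).
Proof.
rewrite openE => x /= /existsNP[U /not_implyP[oU /not_implyP[Ux muU]]].
apply: filterS (open_nbhs_nbhs (conj oU Ux)) => y Uy /= /(_ _ oU Uy).
exact: muU.
Qed.

Lemma bigcup_count_null d (T : measurableType d) (R : realType)
    (mu : {measure set T -> \bar R}) (I : countType) (F : I -> set T) :
  (forall i, measurable (F i)) -> (forall i, mu (F i) = 0%E) ->
  mu (\bigcup_i F i) = 0%E.
Proof.
move=> mF F0; pose G k := if unpickle k is Some i then F i else set0.
have mG k : measurable (G k) by rewrite /G; case: (unpickle _).
have G0 k : mu (G k) = 0%E.
  by rewrite /G; case: (unpickle _) => // ; rewrite measure0.
apply/eqP; rewrite eq_le measure_ge0 andbT.
have : (mu (\bigcup_i F i) <= \sum_(k <oo) mu (G k))%E.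
  apply: measure_sigma_subadditive => //.
    by apply: countable_bigcupT_measurable => //; exact: countableP.
  by move=> x [i _ Fix]; exists (pickle i) => //; rewrite /G pickleK.
by rewrite eseries0.
Qed.

Lemma subset_null d (T : measurableType d) (R : realType)
    (mu : {measure set T -> \bar R}) (A B : set T) :
  measurable A -> measurable B -> A `<=` B -> mu B = 0%E -> mu A = 0%E.
Proof.
move=> mA mB AB B0; apply/eqP; rewrite eq_le measure_ge0 andbT -B0.
by apply: le_measure; rewrite ?inE.
Qed.

(** Lindelöf's argument: each point off the support has a null neighbourhood, hence a null rational
    box around it, and there are countably many boxes. *)
Lemma setC_support_null (R : realType) (n : nat) (mu : borel_measure R n) :
  mu (~` measure_support mu) = 0%E.
Proof.
pose F b : set (Rn R n) := if mu (rat_box b) == 0%E then rat_box b else set0.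
have mF b : measurable (F b).
  by rewrite /F; case: ifP => // _; exact: measurable_rat_box.
have F0 b : mu (F b) = 0%E.
  by rewrite /F; case: ifP => [/eqP//|]; rewrite measure0.
apply: (subset_null _ _ _ (bigcup_count_null mF F0)).
- by apply: open_Rn_measurable; exact: open_setC_support.
- by apply: countable_bigcupT_measurable => //; exact: countableP.
- move=> x /= /existsNP[U /not_implyP[oU /not_implyP[Ux muU]]].
  have [b [bx bU]] := rat_box_base oU Ux.
  exists b => //; rewrite /F ifT//; apply/eqP.
  apply: (@subset_null _ (Rn R n) _ _ _ U) => //.
  - exact: measurable_rat_box.
  - exact: open_Rn_measurable.
  - by apply/eqP; rewrite eq_le measure_ge0 andbT leNgt; apply/negP.
Qed.

(** * Positive definiteness of the Gaussian kernel *)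

Lemma bounded_cvg_Rintegral d (T : measurableType d) (R : realType)
    (P : probability T R) (f_ : nat -> T -> R) (f : T -> R) :
  (forall k, measurable_fun setT (f_ k)) ->
  (forall k x, `|f_ k x| <= 1) ->
  (forall x, f_ k x @[k --> \oo] --> f x) ->
  (\int[P]_x f_ k x)%R @[k --> \oo] --> (\int[P]_x f x)%R.
Proof.
move=> mf_ f_1 f_f.
have mf : measurable_fun setT f by apply: (measurable_fun_cvg mf_) => x _; exact: f_f.
have i1 : P.-integrable setT (EFin \o (fun=> 1 : R)).
  by apply: finite_measure_integrable_cst.
have [intf _ cv] := @dominated_convergence _ T R P setT measurableT
  (fun k => EFin \o f_ k) (EFin \o f) (fun=> 1%E)
  (fun k => proj2 (measurable_EFinP _ _) (mf_ k)) (proj2 (measurable_EFinP _ _) mf)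
  ltac:(apply: aeW => x _ /=; apply: cvg_EFin; [by apply: nearW|exact: f_f])
  i1 ltac:(apply: aeW => x k _ /=; rewrite lee_fin; exact: f_1).
rewrite /Rintegral; apply: fine_cvg; rewrite fineK//.
exact: integrable_fin_num.
Qed.

Lemma bounded_integrable d (T : measurableType d) (R : realType)
    (P : probability T R) (f : T -> R) :
  measurable_fun setT f -> (forall x, `|f x| <= 1) ->
  P.-integrable setT (EFin \o f).
Proof.
move=> mf f1; apply: measurable_bounded_integrable => //.
  by rewrite (le_lt_trans (probability_le1 P measurableT)) ?ltry.
by exists 1; split => // M M1 x _; exact: (le_trans (f1 x) (ltW M1)).
Qed.

Lemma norm_Rintegral_le1 d (T : measurableType d) (R : realType)
    (P : probability T R) (f : T -> R) :
  measurable_fun setT f -> (forall x, `|f x| <= 1) -> `|\int[P]_x f x|%R <= 1.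
Proof.
move=> mf f1.
have i1 : P.-integrable setT (EFin \o f) by exact: bounded_integrable.
apply: (le_trans (le_normr_Rintegral measurableT i1)).
apply: (@le_trans _ _ (\int[P]_x (1 : R))%R).
  apply: le_Rintegral => //.
  - apply: bounded_integrable; first exact: measurableT_comp.
    by move=> y; rewrite normr_id.
  - by apply: bounded_integrable => // y; rewrite normr1.
by rewrite Rintegral_cst// mul1r -lee_fin fineK ?probability_le1 ?fin_num_measure.
Qed.

Section hermite_feature.
Variables (R : realType) (a : R).
Hypothesis a0 : 0 < a.

(* Normalised so that [sum_k gfeat k s * gfeat k t = exp (- a (s - t) ^ 2)]. *)
Definition gfeat (k : nat) (t : R) : R :=
  t ^+ k * expR (- (a * t ^+ 2)) * Num.sqrt ((2 * a) ^+ k / k`!%:R).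

Lemma gfeatM k s t : gfeat k s * gfeat k t =
  exp_coeff (2 * a * (s * t)) k * expR (- (a * s ^+ 2)) * expR (- (a * t ^+ 2)).
Proof.
rewrite /gfeat; set c := (2 * a) ^+ k / _.
have -> : exp_coeff (2 * a * (s * t)) k = c * (s ^+ k * t ^+ k).
  by rewrite /exp_coeff /= exprMn (exprMn _ s t) /c; ring.
have c0 : 0 <= c by rewrite divr_ge0// exprn_ge0// mulr_ge0// ltW.
by rewrite -[in RHS](sqr_sqrtr c0); ring.
Qed.

Lemma cvg_gfeat s t :
  \sum_(k < N) gfeat k s * gfeat k t @[N --> \oo] --> expR (- (a * (s - t) ^+ 2)).
Proof.
have -> : expR (- (a * (s - t) ^+ 2)) = expR (2 * a * (s * t)) *
    (expR (- (a * s ^+ 2)) * expR (- (a * t ^+ 2))).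
  by rewrite -!expRD; congr expR; ring.
rewrite (_ : (fun N => _) = (fun N => series (exp_coeff (2 * a * (s * t))) N *
    (expR (- (a * s ^+ 2)) * expR (- (a * t ^+ 2))))); last first.
  apply/funext => N; rewrite /series /= big_mkord mulr_suml.
  by apply: eq_bigr => k _; rewrite gfeatM; exact/esym/mulrA.
apply: cvgMr_tmp; exact: is_cvg_series_exp_coeff.
Qed.

(** On the diagonal the series has nonnegative terms and sum exp 0 = 1, which bounds its partial
    sums. *)
Lemma sum_gfeat_sqr_le1 N t : \sum_(k < N) gfeat k t ^+ 2 <= 1.
Proof.
have := @cvg_gfeat t t; rewrite subrr expr0n/= mulr0 oppr0 expR0 => cv.
rewrite -(cvg_lim (@Rhausdorff R) cv).
rewrite (_ : \sum_(k < N) gfeat k t ^+ 2 = \sum_(k < N) gfeat k t * gfeat k t)//.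
apply: (@nondecreasing_cvgn_le R (fun N => \sum_(k < N) gfeat k t * gfeat k t)).
  apply/nondecreasing_seqP => m; rewrite big_ord_recr/= lerDl -expr2.
  exact: sqr_ge0.
by apply/cvg_ex; eexists; exact: cv.
Qed.

Lemma gfeat_le1 k t : `|gfeat k t| <= 1.
Proof.
rewrite -sqrtr_sqr -[leRHS]sqrtr1 ler_sqrt//.
apply: le_trans (sum_gfeat_sqr_le1 k.+1 t).
by rewrite big_ord_recr/= lerDr sumr_ge0// => i _; exact: sqr_ge0.
Qed.

(** By |u v| <= (u^2 + v^2) / 2 termwise. The bound is uniform in N, as bounded convergence
    requires. *)
Lemma sum_gfeatM_le1 N s t : `|\sum_(k < N) gfeat k s * gfeat k t| <= 1.
Proof.
apply: (le_trans (ler_norm_sum _ _ _)).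
apply: (@le_trans _ _ (\sum_(k < N) (gfeat k s ^+ 2 + gfeat k t ^+ 2) / 2)).
  apply: ler_sum => k _; rewrite normrM.
  rewrite -(real_normK (num_real (gfeat k s))) -(real_normK (num_real (gfeat k t))).
  have := sqr_ge0 (`|gfeat k s| - `|gfeat k t|); nra.
rewrite -mulr_suml big_split/=.
by have := sum_gfeat_sqr_le1 N s; have := sum_gfeat_sqr_le1 N t; lra.
Qed.

Lemma measurable_gfeat k : measurable_fun setT (gfeat k).
Proof.
apply: measurable_funM => //; apply: measurable_funM; first exact: exprn_measurable.
apply: measurableT_comp; first exact: measurable_expR.
by apply: measurable_funN; apply: measurable_funM.
Qed.

End hermite_feature.

Definition dist2 (R : realType) (n : nat) (x y : 'rV[R]_n) : R :=
  \sum_(i < n) (x ord0 i - y ord0 i) ^+ 2.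

Lemma dist2_ge0 (R : realType) (n : nat) (x y : 'rV[R]_n) : 0 <= dist2 x y.
Proof. by apply: sumr_ge0 => i _; exact: sqr_ge0. Qed.

Lemma dist2C (R : realType) (n : nat) (x y : 'rV[R]_n) : dist2 x y = dist2 y x.
Proof. by apply: eq_bigr => i _; rewrite -sqrrN opprB. Qed.

Lemma measurable_dist2 d (T : measurableType d) (R : realType) (n : nat)
    (f g : T -> Rn R n) :
  measurable_fun setT f -> measurable_fun setT g ->
  measurable_fun setT (fun t => dist2 (f t : 'rV[R]_n) (g t)).
Proof.
move=> mf mg; apply: measurable_sum => i; apply: measurable_funX.
by apply: measurable_funB;
  apply: (measurableT_comp (@measurable_coord R n i)).
Qed.

Definition gauss (R : realType) (n : nat) (a : R) (x y : 'rV[R]_n) : R :=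
  expR (- (a * dist2 x y)).

Lemma gaussC (R : realType) (n : nat) (a : R) (x y : 'rV[R]_n) :
  gauss a x y = gauss a y x.
Proof. by rewrite /gauss dist2C. Qed.

Lemma gauss_ge0 (R : realType) (n : nat) (a : R) (x y : 'rV[R]_n) :
  0 <= gauss a x y.
Proof. exact: expR_ge0. Qed.

Lemma gauss_le1 (R : realType) (n : nat) (a : R) (x y : 'rV[R]_n) :
  0 <= a -> gauss a x y <= 1.
Proof.
by move=> a0; rewrite -expR0 ler_expR oppr_le0 mulr_ge0// dist2_ge0.
Qed.

Lemma norm_gauss_le1 (R : realType) (n : nat) (a : R) (x y : 'rV[R]_n) :
  0 <= a -> `|gauss a x y| <= 1.
Proof. by move=> a0; rewrite ger0_norm ?gauss_ge0// gauss_le1. Qed.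

Lemma measurable_gauss d (T : measurableType d) (R : realType) (n : nat) (a : R)
    (f g : T -> Rn R n) :
  measurable_fun setT f -> measurable_fun setT g ->
  measurable_fun setT (fun t => gauss a (f t : 'rV[R]_n) (g t)).
Proof.
move=> mf mg; apply: measurableT_comp; first exact: measurable_expR.
by apply: measurable_funN; apply: measurable_funM => //; exact: measurable_dist2.
Qed.

Section gauss_feature.
Variables (R : realType) (n : nat) (a : R).
Hypothesis a0 : 0 < a.
Implicit Types (P Q : probability (Rn R n) R) (x y : 'rV[R]_n).

Definition vfeat (al : 'I_n -> nat) x : R := \prod_i gfeat a (al i) (x ord0 i).

Lemma norm_prod_le1 (I : finType) (F : I -> R) :
  (forall i, `|F i| <= 1) -> `|\prod_i F i| <= 1.
Proof.
move=> F1; rewrite normr_prod; apply: prodr_ile1 => i _.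
by rewrite normr_ge0 F1.
Qed.

Lemma vfeat_le1 al x : `|vfeat al x| <= 1.
Proof. by apply: norm_prod_le1 => i; exact: gfeat_le1. Qed.

Lemma measurable_vfeat al : measurable_fun setT (vfeat al : Rn R n -> R).
Proof.
apply: (@measurable_prod _ (Rn R n) R setT _ _
  (fun i (x : Rn R n) => gfeat a (al i) ((x : 'rV[R]_n) ord0 i))) => i _.
exact: (measurableT_comp (measurable_gfeat a (al i)) (@measurable_coord R n i)).
Qed.

Lemma integrable_vfeat P al : P.-integrable setT (EFin \o vfeat al).
Proof.
by apply: bounded_integrable; [exact: measurable_vfeat|exact: vfeat_le1].
Qed.

(** Each one-dimensional series is cut at N, instead of the total degree: the product then inherits
    the bound 1 from its factors, and it expands over all multi-indices with entries below N. *)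
Definition gauss_trunc N x y : R :=
  \prod_i \sum_(k < N) gfeat a k (x ord0 i) * gfeat a k (y ord0 i).

Lemma gauss_truncE N x y : gauss_trunc N x y =
  \sum_(al : {ffun 'I_n -> 'I_N}) vfeat (fun i => al i) x * vfeat (fun i => al i) y.
Proof.
rewrite /gauss_trunc bigA_distr_bigA/=; apply: eq_bigr => al _.
by rewrite -big_split.
Qed.

Lemma gauss_trunc_le1 N x y : `|gauss_trunc N x y| <= 1.
Proof. by apply: norm_prod_le1 => i; exact: sum_gfeatM_le1. Qed.

Lemma cvg_gauss_trunc x y : gauss_trunc N x y @[N --> \oo] --> gauss a x y.
Proof.
rewrite /gauss /dist2 mulr_sumr -sumrN expR_sum.
by apply: cvg_big => [|i _]; [exact: mul_continuous|exact: cvg_gfeat].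
Qed.

Lemma gauss_truncC N x y : gauss_trunc N x y = gauss_trunc N y x.
Proof. by apply: eq_bigr => i _; apply: eq_bigr => k _; rewrite mulrC. Qed.

Lemma measurable_gauss_truncl N y :
  measurable_fun setT ((fun x => gauss_trunc N x y) : Rn R n -> R).
Proof.
under eq_fun do rewrite gauss_truncE.
apply: measurable_sum => al; apply: measurable_funM => //.
exact: measurable_vfeat.
Qed.

Lemma measurable_gauss_truncr N x :
  measurable_fun setT (gauss_trunc N x : Rn R n -> R).
Proof.
rewrite (_ : gauss_trunc N x = gauss_trunc N ^~ x).
  exact: measurable_gauss_truncl.
by apply/funext => y; rewrite gauss_truncC.
Qed.

Definition coef P (al : 'I_n -> nat) : R := (\int[P]_x vfeat al x)%R.

Lemma Rintegral_sum_vfeat P N (c : {ffun 'I_n -> 'I_N} -> R) :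
  (\int[P]_x (\sum_al c al * vfeat (fun i => al i) x))%R =
  \sum_al c al * coef P (fun i => al i).
Proof.
rewrite /Rintegral.
under eq_integral do rewrite -sumEFin.
rewrite integral_sum//; last first.
  move=> al; under eq_fun do rewrite EFinM.
  by apply: integrableZl => //; exact: integrable_vfeat.
under eq_bigr => al _.
  under eq_integral do rewrite EFinM.
  rewrite integralZl//; last exact: integrable_vfeat.
  rewrite -[X in (_ * X)%E]fineK; last first.
    exact/integrable_fin_num/integrable_vfeat.
  rewrite -EFinM; over.
by rewrite sumEFin.
Qed.

Lemma Rintegral_gauss_trunc P N y : (\int[P]_x gauss_trunc N x y)%R =
  \sum_(al : {ffun 'I_n -> 'I_N}) coef P (fun i => al i) * vfeat (fun i => al i) y.
Proof.
under eq_Rintegral do rewrite gauss_truncC gauss_truncE.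
by rewrite Rintegral_sum_vfeat; apply: eq_bigr => al _; rewrite mulrC.
Qed.

Lemma cvg_gauss_pot P y :
  \sum_(al : {ffun 'I_n -> 'I_N}) coef P (fun i => al i) * vfeat (fun i => al i) y
    @[N --> \oo] --> (\int[P]_x gauss a x y)%R.
Proof.
rewrite (_ : (fun N => _) = (fun N => (\int[P]_x gauss_trunc N x y)%R)).
  apply: bounded_cvg_Rintegral => [N|N x|x].
  - exact: measurable_gauss_truncl.
  - exact: gauss_trunc_le1.
  - exact: cvg_gauss_trunc.
by apply/funext => N; rewrite Rintegral_gauss_trunc.
Qed.

Definition gauss_energy P Q : R := (\int[P]_x \int[Q]_y gauss a x y)%R.

Lemma cvg_gauss_energy P Q :
  \sum_(al : {ffun 'I_n -> 'I_N}) coef P (fun i => al i) * coef Q (fun i => al i)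
    @[N --> \oo] --> gauss_energy P Q.
Proof.
pose S N x := (\int[Q]_y gauss_trunc N x y)%R.
have SE N x : S N x = \sum_(al : {ffun 'I_n -> 'I_N})
    coef Q (fun i => al i) * vfeat (fun i => al i) x.
  by rewrite -Rintegral_gauss_trunc; apply: eq_Rintegral => y _; rewrite gauss_truncC.
rewrite (_ : (fun N => _) = (fun N => (\int[P]_x S N x)%R)).
  apply: bounded_cvg_Rintegral => [N|N x|x].
  - rewrite (funext (SE N)).
    apply: measurable_sum => al; apply: measurable_funM => //.
    exact: measurable_vfeat.
  - apply: norm_Rintegral_le1; last first; first by move=> y; exact: gauss_trunc_le1.
    exact: measurable_gauss_truncr.
  - rewrite (_ : (fun N => _) = (fun N => \sum_(al : {ffun 'I_n -> 'I_N})
        coef Q (fun i => al i) * vfeat (fun i => al i) x)); last first.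
      by apply/funext => N; rewrite SE.
    under eq_Rintegral do rewrite gaussC.
    exact: cvg_gauss_pot.
apply/funext => N.
under [RHS]eq_Rintegral do rewrite SE.
rewrite Rintegral_sum_vfeat.
by apply: eq_bigr => al _; rewrite mulrC.
Qed.

(** The energy of P - Q for the Gaussian kernel, also known as the squared maximum mean
    discrepancy. *)
Definition gauss_diff P Q : R :=
  gauss_energy P P - 2 * gauss_energy P Q + gauss_energy Q Q.

Lemma cvg_gauss_diff P Q :
  \sum_(al : {ffun 'I_n -> 'I_N})
      (coef P (fun i => al i) - coef Q (fun i => al i)) ^+ 2
    @[N --> \oo] --> gauss_diff P Q.
Proof.
pose T N P' Q' := \sum_(al : {ffun 'I_n -> 'I_N})
  coef P' (fun i => al i) * coef Q' (fun i => al i).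
rewrite (_ : (fun N => _) = (fun N => T N P P - 2 * T N P Q + T N Q Q)).
  apply: cvgD; last exact: cvg_gauss_energy.
  apply: cvgB; first exact: cvg_gauss_energy.
  by apply: cvgMl_tmp; exact: cvg_gauss_energy.
apply/funext => N; rewrite mulr_sumr -sumrB -big_split/=.
by apply: eq_bigr => al _; ring.
Qed.

Lemma gauss_diff_ge0 P Q : 0 <= gauss_diff P Q.
Proof.
rewrite -(cvg_lim (@Rhausdorff R) (@cvg_gauss_diff P Q)).
apply: limr_ge; first by apply/cvg_ex; eexists; exact: cvg_gauss_diff.
by apply: nearW => N; apply: sumr_ge0 => al _; exact: sqr_ge0.
Qed.

Lemma gauss_diff_eq0_coef P Q : gauss_diff P Q = 0 -> coef P = coef Q.
Proof.
move=> d0; apply/funext => al; apply/eqP; rewrite -subr_eq0 -sqrf_eq0.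
rewrite eq_le sqr_ge0 andbT -d0.
rewrite -(cvg_lim (@Rhausdorff R) (@cvg_gauss_diff P Q)).
apply: limr_ge; first by apply/cvg_ex; eexists; exact: cvg_gauss_diff.
(* Once N exceeds all entries of [al], this multi-index occurs in the sum, so its square is at most
   every later partial sum and thus at most the limit 0. *)
exists (\max_i al i).+1 => // N /= alN.
have alt i : (al i < N)%N by apply: leq_trans alN; rewrite ltnS; exact: leq_bigmax.
pose be : {ffun 'I_n -> 'I_N} := [ffun i => Ordinal (alt i)].
rewrite (bigD1 be)//= (_ : (fun i => nat_of_ord (be i)) = al); last first.
  by apply/funext => i; rewrite ffunE.
by rewrite lerDl; apply: sumr_ge0 => ? _; exact: sqr_ge0.
Qed.

Lemma gauss_diff_eq0 P Q : gauss_diff P Q = 0 ->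
  forall y, (\int[P]_x gauss a x y)%R = (\int[Q]_x gauss a x y)%R.
Proof.
move=> /gauss_diff_eq0_coef cPQ y.
rewrite -(cvg_lim (@Rhausdorff R) (@cvg_gauss_pot P y)) cPQ.
exact: cvg_lim (@cvg_gauss_pot Q y).
Qed.

End gauss_feature.

(** * Masses of spheres from Gaussian potentials *)

Lemma enormE (R : realType) (n : nat) (x y : 'rV[R]_n) :
  enorm (x - y) = Num.sqrt (dist2 x y).
Proof.
by congr Num.sqrt; apply: eq_bigr => i _; rewrite !mxE.
Qed.

Lemma sphereE (R : realType) (n : nat) (x y : 'rV[R]_n) (r : R) : 0 <= r ->
  sphere x r y <-> dist2 y x = r ^+ 2.
Proof.
move=> r0; rewrite /sphere /= enormE; split=> [<-|->].
  by rewrite sqr_sqrtr// dist2_ge0.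
by rewrite sqrtr_sqr ger0_norm.
Qed.

Lemma measurable_sphere (R : realType) (n : nat) (x : 'rV[R]_n) (r : R) :
  measurable (sphere x r : set (Rn R n)).
Proof.
rewrite (_ : sphere x r = (fun y : Rn R n => enorm ((y : 'rV[R]_n) - x)) @^-1` [set r])//.
rewrite -[X in measurable X]setTI.
have : measurable_fun setT (fun y : Rn R n => enorm ((y : 'rV[R]_n) - x)).
  under eq_fun do rewrite enormE.
  apply: measurableT_comp; first by apply: continuous_measurable_fun; exact: sqrt_continuous.
  exact: (@measurable_dist2 _ (Rn R n)).
by apply.
Qed.

Lemma Rintegral_hornerE d (T : measurableType d) (R : realType)
    (P : probability T R) (t : T -> R) (p : {poly R}) :
  measurable_fun setT t -> (forall x, `|t x| <= 1) ->
  (\int[P]_x p.[t x])%R = \sum_(i < size p) p`_i * (\int[P]_x (t x ^+ i))%R.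
Proof.
move=> mt t1.
have it i : P.-integrable setT (EFin \o (fun x => t x ^+ i)).
  apply: bounded_integrable; first exact: measurable_funX.
  by move=> x; rewrite normrX exprn_ile1.
rewrite /Rintegral.
under eq_integral do rewrite horner_coef -sumEFin.
rewrite integral_sum//; last first.
  move=> i; under eq_fun do rewrite EFinM; apply: integrableZl => //; exact: it.
under eq_bigr => i _.
  under eq_integral do rewrite EFinM.
  rewrite integralZl; [|by []|exact: it].
  rewrite -[X in (_ * X)%E]fineK; last by apply: integrable_fin_num (it i).
  rewrite -EFinM; over.
by rewrite sumEFin.
Qed.

Lemma cvg_parabola_exp (R : realType) (t : R) : 0 <= t <= 1 ->
  (4 * (t * (1 - t))) ^+ k @[k --> \oo] --> ((t == 2^-1)%:R : R).
Proof.
move=> /andP[t0 t1].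
have [->|t2] := eqVneq t 2^-1.
  rewrite (_ : 4 * _ = 1); last by field.
  by under eq_fun do rewrite expr1n; exact: cvg_cst.
apply: cvg_expr; rewrite ger0_norm; last first.
  by rewrite mulr_ge0// mulr_ge0// subr_ge0.
have : 0 < (t - 2^-1) ^+ 2 by rewrite exprn_even_gt0//= subr_eq0.
have -> : (t - 2^-1) ^+ 2 = 4^-1 - t * (1 - t) by field.
by lra.
Qed.

Section gauss_sphere.
Variables (R : realType) (n : nat) (P Q : probability (Rn R n) R).
Hypothesis PQ : forall a y, 0 < a ->
  (\int[P]_x gauss a (x : 'rV[R]_n) y)%R = (\int[Q]_x gauss a (x : 'rV[R]_n) y)%R.

(* [4 t (1 - t)] is at most 1 on [0, 1], with equality only at [t = 1/2], so its
   powers applied to a Gaussian that equals 1/2 on the sphere converge to the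
   indicator of the sphere. *)
Lemma eq_gauss_sphere (y : 'rV[R]_n) (r : R) : 0 < r ->
  P (sphere y r) = Q (sphere y r).
Proof.
move=> r0.
pose a := ln 2 / r ^+ 2.
have a0 : 0 < a by rewrite divr_gt0 ?exprn_gt0// ln_gt0// ltr1n.
pose t (x : Rn R n) := gauss a (x : 'rV[R]_n) y.
have mt : measurable_fun setT t by exact: (@measurable_gauss _ (Rn R n)).
have t01 x : 0 <= t x <= 1 by rewrite gauss_ge0 gauss_le1// ltW.
have t1 x : `|t x| <= 1 by rewrite norm_gauss_le1// ltW.
have tS x : (t x == 2^-1) = (x \in sphere y r).
  apply/eqP/idP => [|]; rewrite inE sphereE ?ltW//.
    rewrite -[X in _ = X^-1](@lnK _ 2) ?posrE// -expRN => /expR_inj/oppr_inj.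
    rewrite /a => h.
    have l0 : ln 2 != 0 :> R by rewrite gt_eqF// ln_gt0// ltr1n.
    have r20 : r != 0 by rewrite gt_eqF.
    by apply: (mulfI l0); rewrite -[in RHS]h; field.
  move=> h; rewrite /t /gauss h divfK; last by rewrite gt_eqF ?exprn_gt0.
  by rewrite expRN lnK ?posrE.
have cv (M : probability (Rn R n) R) :
  (\int[M]_x ((4 * (t x * (1 - t x))) ^+ k))%R @[k --> \oo] --> fine (M (sphere y r)).
  have <- : (\int[M]_x \1_(sphere y r) x)%R = fine (M (sphere y r)).
    rewrite /Rintegral integral_indic ?setIT//; exact: measurable_sphere.
  apply: bounded_cvg_Rintegral => [k|k x|x].
  - apply: measurable_funX; apply: measurable_funM => //.
    by apply: measurable_funM => //; exact: measurable_funB.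
  - have /andP[t0x t1x] := t01 x.
    rewrite normrX exprn_ile1// ger0_norm; last first.
      by rewrite mulr_ge0// mulr_ge0// subr_ge0.
    by have := sqr_ge0 (2 * t x - 1); nra.
  - by rewrite indicE -tS; exact: cvg_parabola_exp.
have e : fine (P (sphere y r)) = fine (Q (sphere y r)).
  rewrite -(cvg_lim (@Rhausdorff R) (cv P)) -(cvg_lim (@Rhausdorff R) (cv Q)).
  congr (limn _); apply/funext => k.
  pose p : {poly R} := (4%:P * ('X * (1 - 'X))) ^+ k.
  have pE x : (4 * (t x * (1 - t x))) ^+ k = p.[t x].
    by rewrite /p !hornerE.
  under eq_Rintegral do rewrite pE.
  under [RHS]eq_Rintegral do rewrite pE.
  rewrite !Rintegral_hornerE//; apply: eq_bigr => i _; congr (_ * _).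
  (* A positive power of [t] is again a Gaussian, with parameter [i%:R * a], so [PQ] applies to it;
     the constant monomial integrates to the total mass 1 on both sides. *)
  case: (posnP i) => [->|i0].
    under eq_Rintegral do rewrite expr0.
    under [RHS]eq_Rintegral do rewrite expr0.
    rewrite !Rintegral_cst//; congr (_ * fine _).
    by transitivity (1%E : \bar R); [exact: probability_setT|exact/esym/probability_setT].
  have tE x : t x ^+ i = gauss (i%:R * a) (x : 'rV[R]_n) y.
    by rewrite /t /gauss -expRM_natl mulrN mulrA.
  under eq_Rintegral do rewrite tE.
  under [RHS]eq_Rintegral do rewrite tE.
  by apply: PQ; rewrite mulr_gt0// ltr0n.
by rewrite -[LHS]fineK ?fin_num_measure//; [rewrite e fineK ?fin_num_measure//|]; exact: measurable_sphere.
Qed.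

End gauss_sphere.

(** * The Newtonian kernel as a mixture of Gaussian kernels *)

Section gamma_integral.
Variables (R : realType) (k : nat).
Local Notation leb := (@lebesgue_measure R).
Local Notation D0 := (`[0%R, +oo[%classic : set R).

Definition gaussmom (d t : R) : R := t ^+ k * expR (- (t ^+ 2 * d)).

Lemma continuous_gaussmom d : continuous (gaussmom d).
Proof.
move=> t; apply: cvgM; first exact: exprn_continuous.
apply: continuous_comp; last exact: continuous_expR.
apply: cvgN; apply: cvgM; last exact: cvg_cst.
exact: exprn_continuous.
Qed.

Lemma measurable_gaussmom d : measurable_fun setT (gaussmom d).
Proof. by apply: continuous_measurable_fun; exact: continuous_gaussmom. Qed.

Lemma gaussmom_ge0 d t : 0 <= t -> 0 <= gaussmom d t.
Proof. by move=> t0; rewrite mulr_ge0 ?exprn_ge0// expR_ge0. Qed.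

(** This is Gamma((k+1)/2) / 2. It enters as a common factor, cancelled by means of its positivity
    and finiteness. *)
Definition gamma_mass : \bar R := (\int[leb]_(t in D0) (gaussmom 1 t)%:E)%E.

(** From t^k <= k! exp t and t - t^2 <= 1 - t. The majorant is a multiple of the exponential
    density, whose integral is 1. *)
Lemma gaussmom1_le t : 0 <= t ->
  gaussmom 1 t <= k`!%:R * expR 1 * exponential_pdf 1 t.
Proof.
move=> t0; rewrite exponential_pdfE// mul1r mulN1r /gaussmom mulr1.
have kt : t ^+ k <= k`!%:R * expR t.
  case: k => [|j]; first by rewrite expr0 fact0 mul1r -expR0 ler_expR.
  have := expR_ge1Dxn j t0.
  have f0 : 0 < j.+1`!%:R :> R by rewrite ltr0n fact_gt0.
  move=> h; rewrite -ler_pdivrMl// mulrC.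
  by apply: le_trans h; rewrite lerDr.
apply: (@le_trans _ _ (k`!%:R * expR t * expR (- t ^+ 2))).
  by rewrite ler_wpM2r ?expR_ge0.
rewrite -!mulrA ler_wpM2l ?ler0n// -!expRD ler_expR.
by have := sqr_ge0 (t - 1); nra.
Qed.

Lemma gamma_mass_fin : (gamma_mass < +oo)%E.
Proof.
apply: (@le_lt_trans _ _ (\int[leb]_(t in D0)
    ((k`!%:R * expR 1)%:E * (exponential_pdf 1 t)%:E))%E).
  apply: ge0_le_integral => //.
  - by move=> t /=; rewrite in_itv/= andbT => t0; rewrite lee_fin gaussmom_ge0.
  - apply/measurable_EFinP; apply: measurable_funTS; exact: measurable_gaussmom.
  - apply: measurable_funTS; apply/measurable_EFinP.
    by apply: measurable_funM => //; exact: measurable_exponential_pdf.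
  - by move=> t /=; rewrite in_itv/= andbT => t0; rewrite lee_fin gaussmom1_le.
apply: (@le_lt_trans _ _ (\int[leb]_t
    ((k`!%:R * expR 1)%:E * (exponential_pdf 1 t)%:E))%E).
  apply: ge0_subset_integral => //.
  - apply/measurable_EFinP.
    by apply: measurable_funM => //; exact: measurable_exponential_pdf.
  - by move=> t _; rewrite lee_fin mulr_ge0 ?exponential_pdf_ge0// mulr_ge0 ?expR_ge0.
rewrite ge0_integralZl//.
- by rewrite integral_exponential_pdf// mule1 ltry.
- by apply/measurable_EFinP; exact: measurable_exponential_pdf.
- by move=> t _; rewrite lee_fin exponential_pdf_ge0.
Qed.

Lemma gamma_mass_gt0 : (0 < gamma_mass)%E.
Proof.
apply: (@lt_le_trans _ _ (\int[leb]_(t in `[1%R, 2%R]) (cst (expR (- 4))%:E t))%E).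
  by rewrite integral_cst//= lebesgue_measure_itv/= lte_fin ltr1n -EFinD
    mule_gt0// lte_fin ?expR_gt0//; lra.
apply: (@le_trans _ _ (\int[leb]_(t in `[1%R, 2%R]) (gaussmom 1 t)%:E)%E).
  apply: ge0_le_integral => //.
  - by move=> t _; rewrite lee_fin expR_ge0.
  - by apply/measurable_EFinP; apply: measurable_funTS; exact: measurable_gaussmom.
  - move=> t /=; rewrite in_itv/= => /andP[t1 t2]; rewrite lee_fin /gaussmom mulr1.
    apply: (@le_trans _ _ (1 * expR (- t ^+ 2))).
      by rewrite mul1r ler_expR; nra.
    by rewrite ler_wpM2r ?expR_ge0// exprn_ege1.
apply: ge0_subset_integral => //.
- by apply/measurable_EFinP; apply: measurable_funTS; exact: measurable_gaussmom.
- by move=> t /=; rewrite in_itv/= andbT => t0; rewrite lee_fin gaussmom_ge0.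
- by move=> t /=; rewrite !in_itv/= andbT => /andP[t1 _]; lra.
Qed.

Lemma integral_gaussmom0 : (\int[leb]_(t in D0) (gaussmom 0 t)%:E = +oo)%E.
Proof.
apply/eqP; rewrite -leye_eq.
have <- : (\int[leb]_(t in `[1%R, +oo[) (cst 1%E t) = +oo)%E.
  by rewrite integral_cst//= lebesgue_measure_itv/= ltry mul1e.
apply: (@le_trans _ _ (\int[leb]_(t in `[1%R, +oo[) (gaussmom 0 t)%:E)%E).
  apply: ge0_le_integral => //.
  - by apply/measurable_EFinP; apply: measurable_funTS; exact: measurable_gaussmom.
  - move=> t /=; rewrite in_itv/= andbT => t1.
    by rewrite lee_fin /gaussmom mulr0 oppr0 expR0 mulr1 exprn_ege1.
apply: ge0_subset_integral => //.
- by apply/measurable_EFinP; apply: measurable_funTS; exact: measurable_gaussmom.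
- by move=> t /=; rewrite in_itv/= andbT => t0; rewrite lee_fin gaussmom_ge0.
- by move=> t /=; rewrite !in_itv/= !andbT => t1; lra.
Qed.

(** Substitution of s t for t in [gamma_mass]. With s the distance of two points and k = m, the
    power [k.+1] is the Newtonian exponent n - 2. *)
Lemma integral_gaussmom (s : R) : 0 < s ->
  (\int[leb]_(t in D0) (gaussmom (s ^+ 2) t)%:E = gamma_mass * ((s ^+ k.+1)^-1)%:E)%E.
Proof.
move=> s0.
have dF : (fun t : R => s * t)^`()%classic = cst s.
  apply/funext => t; rewrite derive1E.
  have -> : (fun t : R => s * t) = s \*: (@idfun R) by [].
  by rewrite deriveZ//= derive_id scaler1.
have E t : ((gaussmom 1 \o (fun t => s * t)) * (fun t : R => s * t)^`()%classic) t
    = s ^+ k.+1 * gaussmom (s ^+ 2) t.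
  rewrite dF -[LHS]/(gaussmom 1 (s * t) * s) /gaussmom mulr1.
  rewrite (_ : (s * t) ^+ 2 = t ^+ 2 * s ^+ 2); last by rewrite exprMn mulrC.
  by rewrite exprMn (exprS s k); ring.
have s0' : 0 < s ^+ k.+1 by rewrite exprn_gt0.
have -> : gamma_mass = ((s ^+ k.+1)%:E *
    \int[leb]_(t in D0) (gaussmom (s ^+ 2) t)%:E)%E.
  rewrite -ge0_integralZl//; last 3 first.
  - apply/measurable_EFinP; apply: measurable_funTS; exact: measurable_gaussmom.
  - by move=> t /=; rewrite in_itv/= andbT => t0; rewrite lee_fin gaussmom_ge0.
  - by rewrite lee_fin ltW.
  rewrite /gamma_mass -{1}(mulr0 s).
  rewrite (@increasing_ge0_integration_by_substitutiony R (fun t => s * t)).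
  - by apply: eq_integral => t _; rewrite E EFinM.
  - by move=> x y _ _; rewrite ltr_pM2l.
  - by rewrite dF => x _; exact: cvg_cst.
  - by rewrite dF; exact: is_cvg_cst.
  - by rewrite dF; exact: is_cvg_cst.
  - split; first by move=> x _; exact: derivableM.
    by apply: cvgMl_tmp; exact: cvg_at_right_filter.
  - by apply: gt0_cvgMry => //; exact: cvg_id.
  - by apply: continuous_subspaceT; exact: continuous_gaussmom.
  - by move=> x; rewrite mulr0 in_itv/= andbT => x0; rewrite gaussmom_ge0// ltW.
by rewrite muleC muleA -EFinM mulVf ?mul1e// gt_eqF.
Qed.

End gamma_integral.

Lemma dist2_eq0 (R : realType) (n : nat) (x y : 'rV[R]_n) :
  (dist2 x y == 0) = (x == y).
Proof.
apply/eqP/eqP => [|->]; last by apply: big1 => i _; rewrite subrr expr0n.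
move=> /psumr_eq0P h; apply/rowP => i; apply/eqP; rewrite -subr_eq0 -sqrf_eq0.
by rewrite h// => j _; exact: sqr_ge0.
Qed.

Lemma newton_kernelE (R : realType) (m : nat) (x y : 'rV[R]_m.+3) :
  newton_kernel x y =
  if dist2 x y == 0 then +oo%E else ((Num.sqrt (dist2 x y) ^+ m.+1)^-1)%:E.
Proof.
rewrite /newton_kernel dist2_eq0 enormE; case: ifP => // _; congr EFin.
by rewrite (_ : 2%:Z - m.+3%:Z = - (m.+1%:Z)) ?exprzN//; lia.
Qed.

Lemma newton_kernel_ge0 (R : realType) (n : nat) (x y : 'rV[R]_n) :
  (0 <= newton_kernel x y)%E.
Proof.
by rewrite /newton_kernel; case: ifP => // _; rewrite lee_fin exprz_ge0// sqrtr_ge0.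
Qed.

Lemma newton_kernelC (R : realType) (m : nat) (x y : 'rV[R]_m.+3) :
  newton_kernel x y = newton_kernel y x.
Proof. by rewrite !newton_kernelE dist2C. Qed.

Lemma measurable_newton_kernel d (T : measurableType d) (R : realType) (m : nat)
    (f g : T -> Rn R m.+3) :
  measurable_fun setT f -> measurable_fun setT g ->
  measurable_fun setT (fun t => newton_kernel (f t : 'rV[R]_m.+3) (g t)).
Proof.
move=> mf mg; under eq_fun do rewrite newton_kernelE.
have md := @measurable_dist2 _ _ _ _ _ _ mf mg.
apply: measurable_fun_ifT => //; first exact: measurable_fun_eqr.
apply/measurable_EFinP.
have ms : measurable_fun setT (fun t => Num.sqrt (dist2 (f t : 'rV[R]_m.+3) (g t))).
  apply: measurableT_comp => //.
  by apply: continuous_measurable_fun; exact: sqrt_continuous.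
rewrite (_ : (fun t => _) =
    (fun t => (Num.sqrt (dist2 (f t : 'rV[R]_m.+3) (g t)) ^+ m.+1) `^ (-1))).
  apply: (@measurableT_comp _ _ _ _ _ _ (fun r : R => r `^ (-1))).
    exact: measurable_powR.
  exact: measurable_funX.
by apply/funext => t; rewrite powR_inv1// exprn_ge0// sqrtr_ge0.
Qed.

(** The additive identity has a finite right-hand side, and all terms on the left are nonnegative,
    so J and b are finite as well; after that it can be rearranged in R. Here b stands for the
    mutual energy, whose finiteness is thus a consequence of that of the two self energies. *)
Lemma polarization_ereal (R : realType) (G J a b c : \bar R) :
  (0 < G -> G < +oo -> 0 <= J -> 0 <= a -> 0 <= b -> 0 <= c ->
   a < +oo -> c < +oo -> J + (G * b + G * b) = G * a + G * c ->
   G * (a - b - b + c) = J)%E.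
Proof.
move=> G0 Gf J0 a0 b0 c0 af cf key.
have Gfin : G \is a fin_num by rewrite ge0_fin_numE// ltW.
have af' : a \is a fin_num by rewrite ge0_fin_numE.
have cf' : c \is a fin_num by rewrite ge0_fin_numE.
have Sf : (J + (G * b + G * b) < +oo)%E.
  by rewrite key -(fineK Gfin) -(fineK af') -(fineK cf') -!EFinM -EFinD ltry.
have Jf : J \is a fin_num.
  rewrite ge0_fin_numE//; apply: le_lt_trans Sf; rewrite leeDl// adde_ge0//;
  by rewrite mule_ge0// ltW.
have bf : b \is a fin_num.
  rewrite ge0_fin_numE// ltNge leye_eq; apply/negP => /eqP e.
  by move: Sf; rewrite e gt0_muley// addye// addey// gt_eqF// (lt_le_trans _ J0).
move: key; rewrite -(fineK Gfin) -(fineK af') -(fineK cf') -(fineK bf) -(fineK Jf).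
by rewrite -!EFinM -!EFinD => -[key]; congr EFin; lra.
Qed.

Section energy_gauss.
Variables (R : realType) (m : nat).
Local Notation leb := (@lebesgue_measure R).
Local Notation D0 := (`[0%R, +oo[%classic : set R).
Implicit Types P Q : probability (Rn R m.+3) R.

(* The diagonal is included: both sides are then [+oo]. *)
Lemma newton_gauss (x y : 'rV[R]_m.+3) :
  (\int[leb]_(t in D0) (gaussmom m (dist2 x y) t)%:E =
   gamma_mass R m * newton_kernel x y)%E.
Proof.
rewrite newton_kernelE; case: ifPn => [/eqP ->|d0].
  by rewrite integral_gaussmom0 gt0_muley// gamma_mass_gt0.
rewrite -integral_gaussmom ?sqr_sqrtr ?dist2_ge0// sqrtr_gt0 lt_neqAle.
by rewrite eq_sym d0 dist2_ge0.
Qed.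

(** Extension by 0 to negative t lets the mixture run over the whole line, so that Tonelli's theorem
    applies without restriction of domain. *)
Definition weight (t : R) : R := if 0 <= t then t ^+ m else 0.

Lemma weight_ge0 t : 0 <= weight t.
Proof. by rewrite /weight; case: ifP => // t0; rewrite exprn_ge0. Qed.

Lemma measurable_weight : measurable_fun setT weight.
Proof.
apply: measurable_fun_ifT => //; exact: measurable_fun_ler.
Qed.

Lemma newton_gaussT (x y : 'rV[R]_m.+3) :
  (\int[leb]_t (weight t * gauss (t ^+ 2) x y)%:E =
   gamma_mass R m * newton_kernel x y)%E.
Proof.
rewrite -newton_gauss [RHS]integral_mkcond; apply: eq_integral => t _.
rewrite patchE /weight; case: ifPn => t0.
  by rewrite ifT// inE/= in_itv/= t0.
by rewrite mul0r ifF//; apply/negbTE; rewrite notin_setE/= in_itv/= andbT; apply/negP.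
Qed.

Lemma measurable_weight_gauss d (T : measurableType d) (h : T -> R)
    (f g : T -> Rn R m.+3) :
  measurable_fun setT h -> measurable_fun setT f -> measurable_fun setT g ->
  measurable_fun setT (fun z =>
    (weight (h z) * gauss (h z ^+ 2) (f z : 'rV[R]_m.+3) (g z))%:E).
Proof.
move=> mh mf mg; apply/measurable_EFinP; apply: measurable_funM.
  exact: (measurableT_comp measurable_weight).
apply: measurableT_comp; first exact: measurable_expR.
apply: measurable_funN; apply: measurable_funM; first exact: measurable_funX.
exact: measurable_dist2.
Qed.

Lemma integrable_gauss (a : R) P y : 0 <= a ->
  P.-integrable setT (EFin \o (fun x : Rn R m.+3 => gauss a (x : 'rV[R]_m.+3) y)).
Proof.
move=> a0; apply: bounded_integrable; last by move=> x; exact: norm_gauss_le1.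
exact: (@measurable_gauss _ (Rn R m.+3)).
Qed.

Lemma Rintegral_gaussE (a : R) P y : 0 <= a ->
  (\int[P]_x (gauss a y x)%:E)%E = (\int[P]_x gauss a y x)%R%:E.
Proof.
move=> a0; rewrite /Rintegral fineK//; apply: integrable_fin_num => //.
rewrite (_ : (fun x => _) = EFin \o (fun x : Rn R m.+3 => gauss a (x : 'rV[R]_m.+3) y)).
  exact: integrable_gauss.
by apply/funext => x /=; rewrite gaussC.
Qed.

Lemma measurable_gauss_int (a : R) P :
  measurable_fun setT (fun y : Rn R m.+3 => \int[P]_x (gauss a (y : 'rV[R]_m.+3) x)%:E)%E.
Proof.
apply: (@measurable_fun_fubini_tonelli_F _ _ (Rn R m.+3) (Rn R m.+3) R P
  (fun z => (gauss a (z.1 : 'rV[R]_m.+3) z.2)%:E)).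
  by apply/measurable_EFinP; exact: measurable_gauss.
by move=> z; rewrite lee_fin gauss_ge0.
Qed.

Lemma gauss_energyE (a : R) P Q : 0 <= a ->
  (\int[P]_x \int[Q]_y (gauss a x y)%:E)%E = (gauss_energy a P Q)%:E.
Proof.
move=> a0; under eq_integral do rewrite Rintegral_gaussE//.
rewrite /gauss_energy [in RHS]/Rintegral fineK//; apply: integrable_fin_num => //.
apply: (@bounded_integrable _ (Rn R m.+3)) => [|x].
  apply/measurable_EFinP; apply: eq_measurable_fun (measurable_gauss_int a Q).
  by move=> x _; rewrite Rintegral_gaussE.
apply: norm_Rintegral_le1 => [|y]; last exact: norm_gauss_le1.
exact: (@measurable_gauss _ (Rn R m.+3)).
Qed.

Lemma measurable_weight_gauss_int Q : measurable_fun setT (fun z : Rn R m.+3 * R =>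
  \int[Q]_y (weight z.2 * gauss (z.2 ^+ 2) (z.1 : 'rV[R]_m.+3) y)%:E)%E.
Proof.
apply: (@measurable_fun_fubini_tonelli_F _ _ (Rn R m.+3 * R)%type (Rn R m.+3) R Q
  (fun z => (weight z.1.2 * gauss (z.1.2 ^+ 2) (z.1.1 : 'rV[R]_m.+3) z.2)%:E)).
- by apply: measurable_weight_gauss => //; exact: measurableT_comp.
- by move=> z; rewrite lee_fin mulr_ge0 ?weight_ge0 ?gauss_ge0.
Qed.

Lemma weight_gauss_energyE P Q t : (\int[P]_x \int[Q]_y
    (weight t * gauss (t ^+ 2) (x : 'rV[R]_m.+3) y)%:E =
  (weight t * gauss_energy (t ^+ 2) P Q)%:E)%E.
Proof.
rewrite EFinM -gauss_energyE ?sqr_ge0//.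
rewrite -ge0_integralZl//; last 3 first.
- exact: measurable_gauss_int.
- by move=> x _; apply: integral_ge0 => y _; rewrite lee_fin gauss_ge0.
- by rewrite lee_fin weight_ge0.
apply: eq_integral => x _; rewrite -ge0_integralZl//.
- by apply/measurable_EFinP; exact: (@measurable_gauss _ (Rn R m.+3)).
- by move=> y _; rewrite lee_fin gauss_ge0.
- by rewrite lee_fin weight_ge0.
Qed.

(** Tonelli's theorem, twice: the integral over t is moved out of the inner integral, then out of
    the outer one. *)
Lemma mutual_energy_gauss P Q :
  (gamma_mass R m * mutual_energy P Q =
   \int[leb]_t (weight t * gauss_energy (t ^+ 2) P Q)%:E)%E.
Proof.
have G0 := ltW (gamma_mass_gt0 R m).
have mk : measurable_fun setT (fun z : Rn R m.+3 * Rn R m.+3 =>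
    newton_kernel (z.1 : 'rV[R]_m.+3) z.2) by exact: measurable_newton_kernel.
rewrite /mutual_energy -ge0_integralZl//; last 2 first.
- apply: (@measurable_fun_fubini_tonelli_F _ _ (Rn R m.+3) (Rn R m.+3) R Q
    (fun z => newton_kernel (z.1 : 'rV[R]_m.+3) z.2) mk) => z.
  exact: newton_kernel_ge0.
- by move=> x _; apply: integral_ge0 => y _; exact: newton_kernel_ge0.
transitivity (\int[P]_x \int[leb]_t \int[Q]_y
    (weight t * gauss (t ^+ 2) (x : 'rV[R]_m.+3) y)%:E)%E.
  apply: eq_integral => x _; rewrite -ge0_integralZl//; last 2 first.
  - by apply: (@measurable_newton_kernel _ (Rn R m.+3)).
  - by move=> y _; exact: newton_kernel_ge0.
  under eq_integral do rewrite -newton_gaussT.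
  rewrite (@fubini_tonelli _ _ (Rn R m.+3) _ R Q leb
    (fun z => (weight z.2 * gauss (z.2 ^+ 2) (x : 'rV[R]_m.+3) z.1)%:E))//=.
  - by apply: (@measurable_weight_gauss _ (Rn R m.+3 * R)%type).
  - by move=> z; rewrite lee_fin mulr_ge0 ?weight_ge0 ?gauss_ge0.
rewrite (@fubini_tonelli _ _ (Rn R m.+3) _ R P leb _ (measurable_weight_gauss_int Q))//=; last first.
  by move=> z; apply: integral_ge0 => y _; rewrite lee_fin mulr_ge0 ?weight_ge0 ?gauss_ge0.
by apply: eq_integral => t _; rewrite weight_gauss_energyE.
Qed.

Lemma measurable_weight_gauss_energy P Q :
  measurable_fun setT (fun t => (weight t * gauss_energy (t ^+ 2) P Q)%:E).
Proof.
have := @measurable_fun_fubini_tonelli_G _ _ (Rn R m.+3) R R P _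
  (measurable_weight_gauss_int Q).
move=> /(_ _)/wrap[]; last first.
  by apply: eq_measurable_fun => t _; exact: weight_gauss_energyE.
by move=> z; apply: integral_ge0 => y _; rewrite lee_fin mulr_ge0 ?weight_ge0 ?gauss_ge0.
Qed.

Lemma gauss_energy_ge0 a P Q : 0 <= gauss_energy a P Q.
Proof. by apply: Rintegral_ge0 => x _; apply: Rintegral_ge0 => y _; exact: gauss_ge0. Qed.

Lemma gauss_energy0 P Q : gauss_energy 0 P Q = 1.
Proof.
apply: EFin_inj; rewrite -gauss_energyE//.
have g1 (x y : Rn R m.+3) : gauss 0 (x : 'rV[R]_m.+3) y = 1 :> R.
  by rewrite /gauss mul0r oppr0 expR0.
under eq_integral do under eq_integral do rewrite g1.
have i1 (M : probability (Rn R m.+3) R) : (\int[M]_x 1%:E = 1)%E.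
  by rewrite (integral_cst M measurableT 1%E) mul1e; exact: probability_setT.
by under eq_integral do rewrite i1; exact: i1.
Qed.

(** The feature expansion requires a positive parameter; at t = 0 the kernel is constant and the
    difference is 1 - 2 + 1. *)
Lemma gauss_diff_sqr_ge0 P Q t : 0 <= gauss_diff (t ^+ 2) P Q.
Proof.
have [->|t0] := eqVneq t 0; last by rewrite gauss_diff_ge0// exprn_even_gt0.
by rewrite expr0n/= /gauss_diff !gauss_energy0; lra.
Qed.

Lemma mutual_energyC P Q : mutual_energy P Q = mutual_energy Q P.
Proof.
rewrite /mutual_energy (@fubini_tonelli _ _ (Rn R m.+3) (Rn R m.+3) R P Q
  (fun z => newton_kernel (z.1 : 'rV[R]_m.+3) z.2)).
- by apply: eq_integral => y _; apply: eq_integral => x _; exact: newton_kernelC.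
- exact: measurable_newton_kernel.
- by move=> z; exact: newton_kernel_ge0.
Qed.

Lemma mutual_energy_ge0 (mu nu : borel_measure R m.+3) :
  (0 <= mutual_energy mu nu)%E.
Proof.
by apply: integral_ge0 => x _; apply: integral_ge0 => y _; exact: newton_kernel_ge0.
Qed.

Lemma measurable_weight_gauss_diff P Q :
  measurable_fun setT (fun t => (weight t * gauss_diff (t ^+ 2) P Q)%:E).
Proof.
have mW A B := measurable_weight_gauss_energy A B.
apply/measurable_EFinP.
rewrite (_ : (fun t => _) = (fun t => weight t * gauss_energy (t ^+ 2) P P
  - 2 * (weight t * gauss_energy (t ^+ 2) P Q) + weight t * gauss_energy (t ^+ 2) Q Q)).
  apply: measurable_funD; last by apply/measurable_EFinP; exact: mW.
  apply: measurable_funB; first by apply/measurable_EFinP; exact: mW.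
  by apply: measurable_funM => //; apply/measurable_EFinP; exact: mW.
by apply/funext => t; rewrite /gauss_diff; ring.
Qed.

Lemma energy_diff_gauss P Q :
  (mutual_energy P P < +oo)%E -> (mutual_energy Q Q < +oo)%E ->
  (gamma_mass R m * energy_diff P Q =
   \int[leb]_t (weight t * gauss_diff (t ^+ 2) P Q)%:E)%E.
Proof.
move=> PP QQ.
have G0 := gamma_mass_gt0 R m; have Gf := gamma_mass_fin R m.
pose I (A B : probability (Rn R m.+3) R) :=
  (\int[leb]_t (weight t * gauss_energy (t ^+ 2) A B)%:E)%E.
have IE A B : (I A B = gamma_mass R m * mutual_energy A B)%E.
  by rewrite mutual_energy_gauss.
set J := (\int[leb]_t _)%E.
have Jge0 : (0 <= J)%E.
  by apply: integral_ge0 => t _; rewrite lee_fin mulr_ge0 ?weight_ge0 ?gauss_diff_sqr_ge0.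
have e1 (f g : R -> R) : (forall t, 0 <= f t) -> (forall t, 0 <= g t) ->
    measurable_fun setT (EFin \o f) -> measurable_fun setT (EFin \o g) ->
    (\int[leb]_t (f t + g t)%:E = \int[leb]_t (f t)%:E + \int[leb]_t (g t)%:E)%E.
  move=> f0 g0 mf mg; rewrite -ge0_integralD//.
  - by move=> t _; rewrite lee_fin.
  - by move=> t _; rewrite lee_fin.
have mW A B := measurable_weight_gauss_energy A B.
have W0 (A B : probability (Rn R m.+3) R) t : 0 <= weight t * gauss_energy (t ^+ 2) A B.
  by rewrite mulr_ge0 ?weight_ge0 ?gauss_energy_ge0.
have mD := measurable_weight_gauss_diff P Q.
(* With the cross terms moved to the left all integrands are nonnegative, so additivity of the
   integral holds before anything is known to be finite. *)
have key : (J + (I P Q + I P Q) = I P P + I Q Q)%E.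
  have s1 := esym (e1 _ _ (W0 P Q) (W0 P Q) (mW P Q) (mW P Q)).
  have s2 := esym (e1 _ _ (W0 P P) (W0 Q Q) (mW P P) (mW Q Q)).
  have D0 t : 0 <= weight t * gauss_diff (t ^+ 2) P Q.
    by rewrite mulr_ge0 ?weight_ge0 ?gauss_diff_sqr_ge0.
  have mS := proj2 (measurable_EFinP _ _) (measurable_funD
    (proj1 (measurable_EFinP _ _) (mW P Q)) (proj1 (measurable_EFinP _ _) (mW P Q))).
  have s3 := esym (e1 _ _ D0 (fun t => addr_ge0 (W0 P Q t) (W0 P Q t)) mD mS).
  apply: (etrans (congr1 (fun z => J + z)%E s1)); apply: (etrans s3).
  apply: (etrans _ (esym s2)).
  by apply: eq_integral => t _; congr EFin; rewrite /gauss_diff; ring.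
rewrite /energy_diff (mutual_energyC Q P).
by apply: (polarization_ereal G0 Gf Jge0); rewrite -?IE// mutual_energy_ge0.
Qed.

End energy_gauss.

Section energy_diff_zero.
Variables (R : realType) (m : nat) (P Q : probability (Rn R m.+3) R).
Hypotheses (PP : (mutual_energy P P < +oo)%E) (QQ : (mutual_energy Q Q < +oo)%E).
Local Notation leb := (@lebesgue_measure R).

Lemma energy_diff_ge0 : (0 <= energy_diff P Q)%E.
Proof.
rewrite -(@pmule_rge0 _ (gamma_mass R m)) ?gamma_mass_gt0//.
rewrite energy_diff_gauss//; apply: integral_ge0 => t _.
by rewrite lee_fin mulr_ge0 ?weight_ge0 ?gauss_diff_sqr_ge0.
Qed.

Hypothesis PQ0 : energy_diff P Q = 0%E.

Lemma ae_gauss_diff0 :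
  {ae leb, forall t, (weight m t * gauss_diff (t ^+ 2) P Q)%:E = 0%E}.
Proof.
have := energy_diff_gauss PP QQ; rewrite PQ0 mule0 => /esym h.
have mg : measurable_fun setT (fun t : R => (weight m t * gauss_diff (t ^+ 2) P Q)%:E).
  exact: measurable_weight_gauss_diff.
have [+ _] := @ae_eq_integral_abs _ _ _ leb setT measurableT _ mg.
have -> : (\int[leb]_x `|(weight m x * gauss_diff (x ^+ 2) P Q)%:E| = 0)%E.
  rewrite -[RHS]h; apply: eq_integral => t _; rewrite gee0_abs// lee_fin.
  by rewrite mulr_ge0 ?weight_ge0 ?gauss_diff_sqr_ge0.
by move=> /(_ erefl); apply: filterS => t; apply.
Qed.

(** The exceptional times form a null set, apart from those where the weight vanishes, which are not
    positive; a null set contains no interval of length e. *)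
Lemma near_good_time (s e : R) : 0 < s -> 0 < e ->
  exists t, s <= t <= s + e /\ gauss_diff (t ^+ 2) P Q = 0.
Proof.
move=> s0 e0; apply: contrapT => /forallNP h.
have [A [mA A0 NA]] := ae_gauss_diff0.
have sub : `[s, s + e]%classic `<=` A.
  move=> t; rewrite /= in_itv/= => t1; apply: NA => /= -[] /eqP.
  rewrite mulf_eq0 => /orP[|/eqP tPQ]; last by apply: (h t); rewrite t1.
  have t0 : 0 < t by case/andP: t1 => t1 _; exact: lt_le_trans t1.
  by rewrite /weight ltW// expf_eq0 gt_eqF// andbF.
have : (leb `[s, (s + e)%R]%classic <= leb A)%E by apply: le_measure; rewrite ?inE.
by rewrite A0 lebesgue_measure_itv/= lte_fin ltrDl e0 -EFinD lee_fin; lra.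
Qed.

(** The difference is known to vanish at almost every time only. Good times are chosen converging to
    the square root of a, and the potentials depend continuously on the parameter by bounded
    convergence. *)
Lemma eq_gauss_pot (a : R) (y : 'rV[R]_m.+3) : 0 < a ->
  (\int[P]_x gauss a (x : 'rV[R]_m.+3) y)%R =
  (\int[Q]_x gauss a (x : 'rV[R]_m.+3) y)%R.
Proof.
move=> a0; have s0 : 0 < Num.sqrt a by rewrite sqrtr_gt0.
have /choice[t ht] : forall j : nat, exists t,
    Num.sqrt a <= t <= Num.sqrt a + j.+1%:R^-1 /\ gauss_diff (t ^+ 2) P Q = 0.
  by move=> j; apply: near_good_time => //; rewrite invr_gt0.
have t0 j : 0 < t j ^+ 2.
  have [/andP[h _] _] := ht j; rewrite exprn_even_gt0//= gt_eqF//.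
  exact: lt_le_trans h.
have cvt1 : t j @[j --> \oo] --> Num.sqrt a.
  apply: (@squeeze_cvgr _ _ _ _ (fun=> Num.sqrt a) (fun j => Num.sqrt a + j.+1%:R^-1)).
  - by apply: nearW => j; case: (ht j).
  - exact: cvg_cst.
  - rewrite -[X in _ --> X]addr0; apply: cvgD; first exact: cvg_cst.
    exact: cvg_harmonic.
have cvt : t j ^+ 2 @[j --> \oo] --> a.
  rewrite -[X in _ --> X](sqr_sqrtr (ltW a0)) expr2.
  by under eq_fun do rewrite expr2; exact: cvgM.
have cv (M : probability (Rn R m.+3) R) :
  (\int[M]_x gauss (t j ^+ 2) (x : 'rV[R]_m.+3) y)%R @[j --> \oo] -->
  (\int[M]_x gauss a (x : 'rV[R]_m.+3) y)%R.
  apply: bounded_cvg_Rintegral => [j|j x|x].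
  - exact: (@measurable_gauss _ (Rn R m.+3)).
  - by apply: norm_gauss_le1; exact: sqr_ge0.
  - apply: (@continuous_cvg _ _ _ _ _ (fun j => - (t j ^+ 2 * dist2 x y)) expR).
      exact: continuous_expR.
    by apply: cvgN; apply: cvgMr_tmp.
rewrite -(cvg_lim (@Rhausdorff R) (cv P)) -(cvg_lim (@Rhausdorff R) (cv Q)).
congr (limn _); apply/funext => j; apply: gauss_diff_eq0 => //.
by case: (ht j).
Qed.

Lemma eq_sphere_measure (y : 'rV[R]_m.+3) (r : R) : 0 < r ->
  P (sphere y r) = Q (sphere y r).
Proof. by move=> r0; apply: eq_gauss_sphere => //; exact: eq_gauss_pot. Qed.

End energy_diff_zero.

(** * Capacity of spheres of codimension two *)

(** Nonnegativity of the variance of p, with a the mean. *)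
Lemma sum_sqr_ge (R : realType) (J : finType) (p : J -> R) :
  (\sum_j p j) ^+ 2 <= #|J|%:R * \sum_j p j ^+ 2.
Proof.
have [J0|J0] := posnP #|J|.
  by rewrite !big1 ?expr0n ?mulr0// => j; have := max_card (pred1 j); rewrite card1 J0.
have c0 : 0 < #|J|%:R :> R by rewrite ltr0n.
set s := \sum_j p j; pose a := s / #|J|%:R.
have : 0 <= \sum_j (p j - a) ^+ 2 by apply: sumr_ge0 => j _; exact: sqr_ge0.
have -> : \sum_j (p j - a) ^+ 2 = \sum_j p j ^+ 2 - s ^+ 2 / #|J|%:R.
  rewrite (eq_bigr (fun j => p j ^+ 2 + (- (2 * a) * p j + a ^+ 2))); last first.
    by move=> j _; ring.
  rewrite big_split/= big_split/= -mulr_sumr -/s sumr_const -[_ *+ _]mulr_natl /a.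
  by field; rewrite gt_eqF.
by rewrite subr_ge0 ler_pdivrMr// mulrC.
Qed.

Lemma integral_indicT d (T : measurableType d) (R : realType)
    (mu : {measure set T -> \bar R}) (A : set T) :
  measurable A -> (\int[mu]_x (\1_A x)%:E)%E = mu A.
Proof. by move=> mA; rewrite integral_indic// setIT. Qed.

Section capacity.
Variables (R : realType) (m : nat) (P : probability (Rn R m.+3) R).
Hypothesis PP : (mutual_energy P P < +oo)%E.
Local Notation T := (Rn R m.+3).
Let kap (z : T * T) := newton_kernel (z.1 : 'rV[R]_m.+3) z.2.
Let Dd (K : R) (N : nat) : set (T * T) :=
  [set z | dist2 (z.1 : 'rV[R]_m.+3) z.2 <= (K / N.+1%:R) ^+ 2].

Let mkap : measurable_fun setT kap.
Proof. exact: measurable_newton_kernel. Qed.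

Let mDd K N : measurable (Dd K N).
Proof.
rewrite -[X in measurable X]setTI.
rewrite (_ : Dd K N = (fun z : T * T => dist2 (z.1 : 'rV[R]_m.+3) z.2) @^-1`
   `]-oo, (K / N.+1%:R) ^+ 2]); last first.
  by apply/seteqP; split => z; rewrite /= in_itv/=.
have : measurable_fun setT (fun z : T * T => dist2 (z.1 : 'rV[R]_m.+3) z.2).
  exact: measurable_dist2.
by apply.
Qed.

(** Dominated convergence with the kernel itself as majorant. As the kernel is infinite on the
    diagonal, finite energy makes the diagonal a null set; off it the indicator is eventually 0. *)
Lemma integral_near_diag K :
  (\int[P \x P]_z (kap z * (\1_(Dd K N) z)%:E))%E @[N --> \oo] --> 0%E.
Proof.
have ik : (P \x P)%E.-integrable setT kap.
  apply/integrableP; split => //.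
  under eq_integral do rewrite gee0_abs ?newton_kernel_ge0//.
  rewrite (@fubini_tonelli1 _ _ T T R P P)//.
  by move=> z; exact: newton_kernel_ge0.
have mf N : measurable_fun setT (fun z => kap z * (\1_(Dd K N) z)%:E)%E.
  apply: emeasurable_funM => //; apply/measurable_EFinP.
  exact: measurable_indic.
have := @dominated_convergence _ _ R (P \x P)%E setT measurableT
  (fun N z => kap z * (\1_(Dd K N) z)%:E)%E (fun=> 0%E) kap mf.
move=> /(_ (measurable_cst _))/(_ _ ik)[| |_ _].
- have := integrable_ae measurableT ik; apply: filterS => z /(_ I) fz _.
  have d0 : 0 < dist2 (z.1 : 'rV[R]_m.+3) z.2.
    rewrite lt_neqAle dist2_ge0 andbT eq_sym; apply/negP => e.
    by move: fz; rewrite /kap newton_kernelE e.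
  have c0 : (K / N.+1%:R) ^+ 2 @[N --> \oo] --> (0 : R).
    have c1 : K / N.+1%:R @[N --> \oo] --> (0 : R).
      by rewrite -(mulr0 K); apply: cvgMl_tmp; exact: cvg_harmonic.
    by rewrite -[X in _ --> X](mulr0 (0 : R)); under eq_fun do rewrite expr2; exact: cvgM.
  have [N0 _ hN0] := @cvgr_lt _ _ _ _ _ _ c0 _ d0.
  apply: cvg_near_cst; exists N0 => // N /hN0 /= hN.
  by rewrite indicE memNset ?mule0//= /Dd/=; apply/negP; rewrite -ltNge.
- apply: aeW => z N _; rewrite gee0_abs; last first.
    by rewrite mule_ge0 ?newton_kernel_ge0// lee_fin.
  rewrite -[leRHS]mule1 lee_wpmul2l ?newton_kernel_ge0// lee_fin indicE.
  by case: (_ \in _).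
- by rewrite integral0.
Qed.

Variables (S : set T) (K : R).
Hypotheses (mS : measurable S) (K0 : 0 < K).

(* Each piece has energy at least [P (Sj j) ^ 2 (K / (N + 1)) ^ (- (m + 1))], and
   Cauchy-Schwarz over the pieces recovers [P S ^ 2]. *)
Lemma cover_estimate (J : finType) (N : nat) (Sj : J -> set T) :
  (#|J| <= (2 * N.+1) ^ m.+1)%N ->
  (forall j, measurable (Sj j)) ->
  S `<=` \bigcup_j Sj j ->
  (forall x j k, Sj j x -> Sj k x -> j = k) ->
  (forall j x y, Sj j x -> Sj j y ->
     dist2 (x : 'rV[R]_m.+3) y <= (K / N.+1%:R) ^+ 2) ->
  ((fine (P S) ^+ 2)%:E <=
   ((2 * K) ^+ m.+1)%:E * \int[P \x P]_z (kap z * (\1_(Dd K N) z)%:E))%E.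
Proof.
move=> cJ mSj cov disj diam.
pose p j := fine (P (Sj j)).
have pE j : P (Sj j) = (p j)%:E by rewrite /p fineK// fin_num_measure.
have p0 j : 0 <= p j by rewrite fine_ge0.
have PS : fine (P S) <= \sum_j p j.
  rewrite -lee_fin fineK ?fin_num_measure// -sumEFin.
  under eq_bigr do rewrite -pE -integral_indicT//.
  rewrite -integral_indicT// -ge0_integral_sum; [|by []|
    by move=> j; apply/measurable_EFinP; exact: measurable_indic|
    by move=> j x _; rewrite lee_fin].
  apply: ge0_le_integral => //.
  - by apply/measurable_EFinP; exact: measurable_indic.
  - apply: emeasurable_sum => j; apply/measurable_EFinP; exact: measurable_indic.
  - move=> x _; rewrite sumEFin lee_fin indicE.
    have [/set_mem Sx|_] := boolP (x \in S); last by rewrite sumr_ge0.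
    have [j _ Sjx] := cov _ Sx.
    rewrite (bigD1 j)//= indicE mem_set// lerDl; apply: sumr_ge0 => i _.
    by rewrite /indic; case: (_ \in _); rewrite ?ler01 ?lexx.
set I := (\int[_]_z _)%E.
pose c := ((K / N.+1%:R) ^+ m.+1)^-1.
have KN : 0 < K / N.+1%:R by rewrite divr_gt0.
have c0 : 0 < c by rewrite invr_gt0 exprn_gt0.
have sqI : ((c * \sum_j p j ^+ 2)%:E <= I)%E.
  have -> : ((c * \sum_j p j ^+ 2)%:E =
      \int[P \x P]_z \sum_j (c * \1_(Sj j `*` Sj j) z)%:E)%E.
    rewrite ge0_integral_sum; [|by []| |
      by move=> j z _; rewrite lee_fin mulr_ge0// ltW]; last first.
      move=> j; apply/measurable_EFinP; apply: measurable_funM => //.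
      by apply: measurable_indic; exact: measurableX.
    rewrite mulr_sumr -sumEFin; apply: eq_bigr => j _.
    under eq_integral do rewrite EFinM.
    rewrite ge0_integralZl; [|by []| |by move=> z _; rewrite lee_fin|
      by rewrite lee_fin ltW]; last first.
      by apply/measurable_EFinP; apply: measurable_indic; exact: measurableX.
    rewrite integral_indicT; last exact: measurableX.
    rewrite [X in (_ * X)%E](@product_measure1E _ _ T T R P P _ _ (mSj j) (mSj j)).
    by rewrite EFinM expr2 EFinM -!pE.
  apply: ge0_le_integral => //.
  - by move=> z _; apply: sume_ge0 => j _; rewrite lee_fin mulr_ge0// ltW.
  - apply: emeasurable_sum => j; apply/measurable_EFinP; apply: measurable_funM => //.
    by apply: measurable_indic; exact: measurableX.
  - apply: emeasurable_funM => //; apply/measurable_EFinP; exact: measurable_indic.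
  - move=> z _.
    have k0 : (0 <= kap z * (\1_(Dd K N) z)%:E)%E.
      by rewrite mule_ge0 ?newton_kernel_ge0// lee_fin.
    (* The pieces are disjoint, so at most one term of the sum is nonzero at z, and there the
       diameter bound makes the kernel at least c. *)
    have [[j [z1 z2]]|nz] := pselect (exists j, (Sj j `*` Sj j) z); last first.
      rewrite big1// => j _; rewrite indicE memNset ?mulr0// => zj.
      by apply: nz; exists j.
    rewrite (bigD1 j)//= big1 ?adde0; last first.
      move=> i ij; rewrite indicE memNset ?mulr0//= => -[i1 _].
      by move: ij; rewrite (disj _ _ _ i1 z1) eqxx.
    rewrite indicE mem_set// mulr1 indicE mem_set ?mule1; last exact: diam z1 z2.
    rewrite /kap newton_kernelE; case: ifPn => [_|dz]; first by rewrite leey.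
    have dz0 : 0 < dist2 (z.1 : 'rV[R]_m.+3) z.2 by rewrite lt_neqAle eq_sym dz dist2_ge0.
    rewrite lee_fin /c lef_pV2 ?posrE ?exprn_gt0 ?sqrtr_gt0//.
    rewrite lerXn2r ?nnegrE ?sqrtr_ge0 ?(ltW KN)//.
    by rewrite -[leRHS]gtr0_norm// -sqrtr_sqr ler_sqrt ?sqr_ge0//; exact: diam z1 z2.
have I0 : (0 <= I)%E.
  by apply: integral_ge0 => z _; rewrite mule_ge0 ?newton_kernel_ge0// lee_fin.
apply: (@le_trans _ _ (((2 * K) ^+ m.+1)%:E * (c * \sum_j p j ^+ 2)%:E)%E); last first.
  by rewrite lee_wpmul2l// lee_fin exprn_ge0// mulr_ge0// ltW.
rewrite -EFinM lee_fin.
apply: (@le_trans _ _ ((\sum_j p j) ^+ 2)).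
  by rewrite lerXn2r ?nnegrE ?fine_ge0// sumr_ge0.
apply: (le_trans (sum_sqr_ge p)); rewrite mulrA ler_wpM2r//.
  by apply: sumr_ge0 => j _; exact: sqr_ge0.
(* The number of pieces and the kernel at distance K / (N + 1) grow with the same power of N + 1, so
   their quotient, the constant in the estimate, is independent of N. *)
apply: (@le_trans _ _ ((2 * N.+1)%N%:R ^+ m.+1)); first by rewrite -natrX ler_nat.
rewrite /c -exprVn -exprMn (_ : 2 * K * _ = (2 * N.+1)%N%:R)//.
have K0' : K != 0 by rewrite gt_eqF.
by rewrite natrM invf_div -mulrA (mulrCA K) mulfV// mulr1.
Qed.

Lemma null_of_covers :
  (forall N, exists (J : finType) (Sj : J -> set T),
  [/\ (#|J| <= (2 * N.+1) ^ m.+1)%N,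
  (forall j, measurable (Sj j)),
  S `<=` \bigcup_j Sj j,
  (forall x j k, Sj j x -> Sj k x -> j = k) &
  (forall j x y, Sj j x -> Sj j y ->
     dist2 (x : 'rV[R]_m.+3) y <= (K / N.+1%:R) ^+ 2)]) -> P S = 0%E.
Proof.
move=> cov.
have c : (((2 * K) ^+ m.+1)%:E * \int[P \x P]_z (kap z * (\1_(Dd K N) z)%:E))%E
   @[N --> \oo] --> 0%E.
  by rewrite -[X in _ --> X](mule0 ((2 * K) ^+ m.+1)%:E);
    apply: cvgeZl => //; exact: integral_near_diag.
have : ((fine (P S) ^+ 2)%:E <= 0)%E.
  rewrite -(cvg_lim (@ereal_hausdorff R) c); apply: lime_ge.
    by apply/cvg_ex; eexists; exact: c.
  apply: nearW => N; have [J [Sj [h1 h2 h3 h4 h5]]] := cov N.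
  exact: (cover_estimate h1 h2 h3 h4 h5).
rewrite lee_fin => h.
have /eqP : fine (P S) ^+ 2 == 0 by rewrite eq_le h sqr_ge0.
by move=> /eqP; rewrite sqrf_eq0 => /eqP h0; rewrite -(@fineK _ (P S)) ?h0// fin_num_measure.
Qed.

End capacity.

Section slice.
Variables (R : realType) (m : nat).
Local Notation T := (Rn R m.+3).

(** The section of a sphere centred on the first axis by the hyperplane x_0 = c. [rho2] is the
    square of the radius of the section; it may be zero or negative, when the spheres touch or miss
    each other. *)
Definition slice (c rho2 : R) : set 'rV[R]_m.+3 :=
  [set x | x ord0 ord0 = c /\ \sum_(i < m.+2) x ord0 (lift ord0 i) ^+ 2 = rho2].

Lemma measurable_slice c rho2 : measurable (slice c rho2 : set T).
Proof.
have m0 := @measurable_coord R m.+3 ord0.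
have m1 : measurable_fun setT
    (fun x : T => \sum_(i < m.+2) (x : 'rV[R]_m.+3) ord0 (lift ord0 i) ^+ 2).
  by apply: measurable_sum => i; apply: measurable_funX; exact: measurable_coord.
rewrite (_ : slice c rho2 = (fun x : T => (x : 'rV[R]_m.+3) ord0 ord0) @^-1` [set c] `&`
  (fun x : T => \sum_(i < m.+2) (x : 'rV[R]_m.+3) ord0 (lift ord0 i) ^+ 2) @^-1` [set rho2])//.
by apply: measurableI; rewrite -[X in measurable X]setTI; [exact: m0|exact: m1].
Qed.

Lemma dist2_split (i : 'I_m.+2) (x y : 'rV[R]_m.+3) :
  dist2 x y = (x ord0 ord0 - y ord0 ord0) ^+ 2 +
    ((x ord0 (lift ord0 i) - y ord0 (lift ord0 i)) ^+ 2 +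
     \sum_(l < m.+1) (x ord0 (lift ord0 (lift i l)) - y ord0 (lift ord0 (lift i l))) ^+ 2).
Proof. by rewrite /dist2 (bigD1_ord ord0)//= (bigD1_ord i). Qed.

Section pieces.
Variables (c rho del : R) (i : 'I_m.+2) (s : bool).
Hypotheses (rho0 : 0 < rho) (del0 : 0 < del).

Let ci (x : 'rV[R]_m.+3) := x ord0 (lift ord0 i).
Let co (l : 'I_m.+1) (x : 'rV[R]_m.+3) := x ord0 (lift ord0 (lift i l)).

(* Here [x_i] is a Lipschitz function of the [m + 1] coordinates [co l]. *)
Definition slice_piece : set 'rV[R]_m.+3 :=
  slice c (rho ^+ 2) `&` [set x | del <= (-1) ^+ s * ci x].

Lemma slice_pieceE x : slice_piece x ->
  [/\ x ord0 ord0 = c, ci x ^+ 2 + \sum_l co l x ^+ 2 = rho ^+ 2,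
      del <= (-1) ^+ s * ci x & forall l, `|co l x| <= rho].
Proof.
move=> [[x0 xr] /= xd].
have e : ci x ^+ 2 + \sum_l co l x ^+ 2 = rho ^+ 2 by rewrite -xr (bigD1_ord i).
split => // l; rewrite -[leRHS]gtr0_norm// -sqrtr_sqr -[leRHS]sqrtr_sqr ler_sqrt ?sqr_ge0//.
rewrite -e (bigD1 l)//= addrCA lerDl addr_ge0 ?sqr_ge0// sumr_ge0// => j _.
exact: sqr_ge0.
Qed.

(** On the slice, ci(x)^2 - ci(y)^2 is the sum of the co(y)^2 - co(x)^2, hence at most (m+1) h 2 rho
    in absolute value; on a piece |ci(x) + ci(y)| is at least 2 del, and division bounds the
    remaining coordinate. *)
Lemma slice_piece_dist (h : R) x y : slice_piece x -> slice_piece y -> 0 <= h ->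
  (forall l, `|co l x - co l y| <= h) ->
  dist2 x y <= (m.+1%:R * h * rho / del + m.+1%:R * h) ^+ 2.
Proof.
move=> /slice_pieceE[x0 xr xd xl] /slice_pieceE[y0 yr yd yl] h0 hl.
set B := m.+1%:R * h * rho / del.
have m1 : 1 <= m.+1%:R :> R by rewrite ler1n.
have B0 : 0 <= B by rewrite divr_ge0 ?(ltW del0)// mulr_ge0 ?(ltW rho0)// mulr_ge0.
have ciB : `|ci x - ci y| <= B.
  rewrite /B ler_pdivlMr//.
  have d2 : 2 * del <= `|ci x + ci y|.
    have : 2 * del <= (-1) ^+ s * (ci x + ci y) by rewrite mulrDr; lra.
    move=> /le_trans; apply; apply: (le_trans (ler_norm _)).
    by rewrite normrM normrX normrN1 expr1n mul1r.
  have e : `|ci x - ci y| * `|ci x + ci y| <= m.+1%:R * h * (2 * rho).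
    rewrite -normrM -subr_sqr.
    have -> : ci x ^+ 2 - ci y ^+ 2 = \sum_l (co l y ^+ 2 - co l x ^+ 2).
      by rewrite sumrB; lra.
    apply: (le_trans (ler_norm_sum _ _ _)).
    apply: (@le_trans _ _ (\sum_(l < m.+1) h * (2 * rho))); last first.
      by rewrite sumr_const card_ord -[_ *+ _]mulr_natl mulrA.
    apply: ler_sum => l _; rewrite subr_sqr normrM ler_pM// 1?distrC//.
    by apply: (le_trans (ler_normD _ _)); have := xl l; have := yl l; lra.
  have := ler_wpM2l (normr_ge0 (ci x - ci y)) d2; lra.
rewrite (dist2_split i) x0 y0 subrr expr0n/= add0r.
apply: (@le_trans _ _ (B ^+ 2 + m.+1%:R * h ^+ 2)).
  apply: lerD.
    by rewrite -real_normK ?num_real// lerXn2r ?nnegrE.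
  apply: (@le_trans _ _ (\sum_(l < m.+1) h ^+ 2)); last first.
    by rewrite sumr_const card_ord -[_ *+ _]mulr_natl.
  apply: ler_sum => l _; rewrite -real_normK ?num_real// lerXn2r ?nnegrE//.
  exact: hl.
have : m.+1%:R * h ^+ 2 <= (m.+1%:R * h) ^+ 2.
  by rewrite exprMn ler_wpM2r ?sqr_ge0// expr2 ler_peMl// ler0n.
have : 0 <= B * (m.+1%:R * h) by apply: mulr_ge0 => //; apply: mulr_ge0.
move: (m.+1%:R * h) (m.+1%:R * h ^+ 2) => u v Bu vu.
by rewrite sqrrD -mulr_natl; lra.
Qed.

Lemma measurable_slice_piece : measurable (slice_piece : set T).
Proof.
apply: measurableI; first exact: measurable_slice.
have mci : measurable_fun setT (fun x : T => (-1) ^+ s * ci x).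
  by apply: measurable_funM => //; exact: measurable_coord.
rewrite -[X in measurable X]setTI.
rewrite (_ : [set x | _] = (fun x : T => (-1) ^+ s * ci x) @^-1` `[del, +oo[).
  exact: mci.
by apply/seteqP; split => x; rewrite /= in_itv/= andbT.
Qed.

Lemma slice_piece_null (P : probability T R) :
  (mutual_energy P P < +oo)%E -> P slice_piece = 0%E.
Proof.
move=> PP.
(* The bound of [slice_piece_dist] is linear in h; K / (N + 1) is its value for the mesh h = 2 rho /
   (N + 1). *)
pose K := m.+1%:R * (2 * rho) * rho / del + m.+1%:R * (2 * rho).
have K0 : 0 < K by rewrite addr_gt0// ?divr_gt0// ?mulr_gt0// ?mulr_gt0.
apply: (null_of_covers PP measurable_slice_piece K0) => N.
(* [g] maps [-rho, rho] onto [0, N + 1], and pieces are told apart by integer parts. The endpoint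
   rho has integer part N + 1, so there are N + 2 classes per coordinate, which is at most 2 (N +
   1). *)
pose g l (x : T) := (co l x + rho) * (N.+1%:R / (2 * rho)).
have c0 : 0 < N.+1%:R / (2 * rho) by rewrite divr_gt0// mulr_gt0.
exists {ffun 'I_m.+1 -> 'I_N.+2}, (fun k : {ffun 'I_m.+1 -> 'I_N.+2} => slice_piece `&`
  \bigcap_(l in [set: 'I_m.+1]) (g l @^-1` `[(k l : nat)%:R, (k l : nat).+1%:R[)); split.
- by rewrite card_ffun !card_ord leq_exp2r//; lia.
- move=> k; apply: measurableI; first exact: measurable_slice_piece.
  apply: fin_bigcap_measurable => // l _; rewrite -[X in measurable X]setTI.
  have mg : measurable_fun setT (g l).
    apply: measurable_funM => //; apply: measurable_funD => //.
    exact: measurable_coord.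
  exact: mg.
- move=> x Sx; have [_ _ _ xl] := slice_pieceE Sx.
  have g0 l : 0 <= g l x.
    by rewrite mulr_ge0 ?(ltW c0)//; have := xl l; rewrite ler_norml; lra.
  have gN l : (Num.truncn (g l x) < N.+2)%N.
    rewrite ltnS -(ler_nat R); apply: (@le_trans _ _ (g l x)); first by rewrite truncn_le g0.
    rewrite /g mulrA ler_pdivrMr ?mulr_gt0// [leRHS]mulrC ler_wpM2r ?ler0n//.
    by have := xl l; rewrite ler_norml; lra.
  exists [ffun l => Ordinal (gN l)] => //; split => // l _.
  by rewrite ffunE /= in_itv/= truncn_le ?g0//= truncnS_gt.
- move=> x j k [_ xj] [_ xk]; apply/ffunP => l; apply: val_inj.
  have := xj l I; have := xk l I; rewrite /= !in_itv/= => /andP[k1 k2] /andP[j1 j2].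
  have jk : (j l < (k l).+1)%N by rewrite -(ltr_nat R) (le_lt_trans j1 k2).
  have kj : (k l < (j l).+1)%N by rewrite -(ltr_nat R) (le_lt_trans k1 j2).
  by apply/eqP; rewrite eqn_leq -ltnS jk -ltnS kj.
- move=> k x y [Sx xk] [Sy yk].
  have -> : K / N.+1%:R = m.+1%:R * (2 * rho / N.+1%:R) * rho / del +
     m.+1%:R * (2 * rho / N.+1%:R).
    by rewrite /K; field; rewrite !gt_eqF// addr_gt0.
  apply: slice_piece_dist => // [|l]; first by rewrite divr_ge0// mulr_ge0// ltW.
  have := xk l I; have := yk l I; rewrite /= !in_itv/= => /andP[k1 k2] /andP[j1 j2].
  have : `|g l x - g l y| <= 1.
    by rewrite ler_norml; move: k2 j2; rewrite -!natr1; lra.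
  have -> : g l x - g l y = (co l x - co l y) * (N.+1%:R / (2 * rho)).
    by rewrite /g; ring.
  by rewrite normrM (gtr0_norm c0) -ler_pdivlMr// div1r invf_div.
Qed.

End pieces.

End slice.

Section slice_null.
Variables (R : realType) (m : nat) (P : probability (Rn R m.+3) R).
Hypothesis PP : (mutual_energy P P < +oo)%E.
Local Notation T := (Rn R m.+3).

(** If the radius is positive, some coordinate has square at least rho2 / (m + 2), so the pieces
    over all coordinates and signs cover the slice. Otherwise the slice has at most one point and is
    its own cover, of diameter 0, for every N. *)
Lemma slice_null (c rho2 : R) : P (slice c rho2 : set T) = 0%E.
Proof.
have [rho0|rho0] := ltP 0 rho2; last first.
  have coord0 (x : 'rV[R]_m.+3) : slice c rho2 x -> forall i, x ord0 (lift ord0 i) = 0.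
    move=> [_ xs] i; apply/eqP; rewrite -sqrf_eq0 eq_le sqr_ge0 andbT.
    apply: le_trans rho0; rewrite -xs (bigD1 i)//= lerDl sumr_ge0// => j _.
    exact: sqr_ge0.
  apply: (@null_of_covers _ _ _ PP _ 1 (measurable_slice _ _) ltr01) => N.
  exists unit, (fun=> slice c rho2); split => //.
  - by rewrite card_unit expn_gt0.
  - by move=> _; exact: measurable_slice.
  - by move=> x Sx; exists tt.
  - by move=> x [] [].
  - move=> _ x y Sx Sy; rewrite (_ : x = y :> 'rV[R]_m.+3).
      by rewrite (_ : dist2 _ _ = 0) ?sqr_ge0//; apply/eqP; rewrite dist2_eq0.
    apply/rowP => i; case: (unliftP ord0 i) => [j ->|->].
      by rewrite (coord0 x)// (coord0 y).
    by rewrite (proj1 Sx) (proj1 Sy).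
pose rho := Num.sqrt rho2; pose del := Num.sqrt (rho2 / m.+2%:R).
have rhoP : 0 < rho by rewrite sqrtr_gt0.
have delP : 0 < del by rewrite sqrtr_gt0 divr_gt0.
have rhoE : rho ^+ 2 = rho2 by rewrite sqr_sqrtr// ltW.
pose F (b : 'I_m.+2 * bool) : set T := slice_piece c rho del b.1 b.2.
have mF b : measurable (F b) by exact: measurable_slice_piece.
have F0 b : P (F b) = 0%E by exact: slice_piece_null.
apply: (subset_null _ _ _ (bigcup_count_null mF F0)).
- exact: measurable_slice.
- by apply: countable_bigcupT_measurable => //; exact: countableP.
move=> x Sx; apply: contrapT => nx.
have lt i : x ord0 (lift ord0 i) ^+ 2 < rho2 / m.+2%:R.
  rewrite ltNge; apply/negP => xi; apply: nx.
  have d : del <= `|x ord0 (lift ord0 i)| by rewrite -sqrtr_sqr ler_sqrt// sqr_ge0.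
  exists (i, x ord0 (lift ord0 i) < 0) => //; split => /=; first by rewrite rhoE.
  by move: d; case: ltrP => x0; rewrite ?expr1 ?expr0 ?mul1r ?mulN1r
    ?(ltr0_norm x0) ?(ger0_norm x0).
have : \sum_(i < m.+2) x ord0 (lift ord0 i) ^+ 2 < \sum_(i < m.+2) rho2 / m.+2%:R.
  by apply: ltr_sum => //; apply/hasP; exists ord0; rewrite // mem_index_enum.
by rewrite (proj2 Sx) sumr_const card_ord -[_ *+ _]mulr_natr divfK ?ltxx// pnatr_eq0.
Qed.

Lemma dist2_center (x : 'rV[R]_m.+3) k : dist2 x (Defs.center R m.+3 k) =
  (x ord0 ord0 - k%:R) ^+ 2 + \sum_(i < m.+2) x ord0 (lift ord0 i) ^+ 2.
Proof.
rewrite /dist2 big_ord_recl mxE/=; congr (_ + _); apply: eq_bigr => i _.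
by rewrite mxE/= subr0.
Qed.

(** Distinct concentric spheres are disjoint. For different centres on the first axis, the
    difference of the two equations is linear in x_0 alone; it fixes x_0 = c and puts the
    intersection into a slice. *)
Lemma sphere_meet_null (j k : nat) (r s : R) : 0 < r -> 0 < s ->
  (j, r) <> (k, s) ->
  P (sphere (Defs.center R m.+3 j) r `&` sphere (Defs.center R m.+3 k) s : set T) = 0%E.
Proof.
move=> r0 s0 jk.
have [jk'|jk'] := eqVneq j k.
  rewrite (_ : _ `&` _ = set0) ?measure0//; rewrite -subset0 => x [xj xk].
  by apply: jk; move: xj xk; rewrite /sphere/= jk' => -> ->.
have jk0 : j%:R - k%:R != 0 :> R by rewrite subr_eq0 eqr_nat.
pose c := ((r ^+ 2 - s ^+ 2) - (j%:R ^+ 2 - k%:R ^+ 2)) / (2 * (k%:R - j%:R)) : R.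
apply: (subset_null _ _ _ (slice_null c (r ^+ 2 - (c - j%:R) ^+ 2))).
- by apply: measurableI; exact: measurable_sphere.
- exact: measurable_slice.
move=> x [/(sphereE _ _ (ltW r0)) + /(sphereE _ _ (ltW s0))].
rewrite !dist2_center => xj xk.
have x0c : x ord0 ord0 = c.
  have kj0 : 2 * (k%:R - j%:R) != 0 :> R by rewrite mulf_neq0// -opprB oppr_eq0.
  by apply: (mulIf kj0); rewrite /c divfK// -xj -xk; ring.
by split => //=; rewrite -x0c -xj; ring.
Qed.

End slice_null.

(** * Admissible pairs have nonzero energy difference *)

Lemma measure_probability d (T : measurableType d) (R : realType)
    (mu : {measure set T -> \bar R}) :
  mu setT = 1%E -> exists P : probability T R, mu = P.
Proof.
move=> muT; exists (mnormalize mu (@dirac d T point R : probability T R)).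
apply: eq_measure; apply/funext => B.
rewrite -[RHS]/((if (mu setT == 0) || (mu setT == +oo) then fun U => \d_point U
  else fun U => mu U * (fine (mu setT))^-1%:E)%E B).
by rewrite muT eqe oner_eq0 /= invr1 mule1.
Qed.

Lemma measurable_sphere_union (R : realType) (n : nat) (r : nat -> R) :
  measurable (sphere_union (n := n) r : set (Rn R n)).
Proof. by apply: bigcup_measurable => k _; exact: measurable_sphere. Qed.

(** The complement of the support is null, so a support inside A leaves no mass outside A and the
    total mass is that of A. *)
Lemma admissible_probability (R : realType) (n : nat) (A : set (Rn R n))
    (mu : borel_measure R n) : measurable A -> admissible A mu ->
  exists P : probability (Rn R n) R, mu = P.
Proof.
move=> mA [_ _ suppA muA].
have mC : measurable (~` A) by exact: measurableC.
have C0 : mu (~` A) = 0%E.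
  apply: (@subset_null _ (Rn R n) _ _ _ (~` measure_support mu)) => //.
  - by apply: open_Rn_measurable; exact: open_setC_support.
  - exact: subsetC.
  - exact: setC_support_null.
have muT : mu setT = 1%E.
  have := @measureU _ _ _ mu A (~` A) mA mC (setICr A).
  by rewrite setUv => ->; rewrite [X in (_ + X)%E]C0 adde0.
exact: measure_probability muT.
Qed.

Lemma energy_diff_neq0 (R : realType) (m : nat) (r1 r2 : nat -> R)
    (P Q : probability (Rn R m.+3) R) :
  (forall k, (2 <= k)%N -> 0 < r1 k) -> (forall k, (2 <= k)%N -> 0 < r2 k) ->
  (forall k, (2 <= k)%N -> r1 k != r2 k) ->
  admissible (sphere_union r1) P -> admissible (sphere_union r2) Q ->
  energy_diff P Q <> 0%E.
Proof.
move=> r10 r20 r12 adP adQ PQ0.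
have [_ PP _ P1] := adP; have [_ QQ suppQ Q1] := adQ.
have QC : Q (~` sphere_union r2) = 0%E.
  apply: (@subset_null _ (Rn R m.+3) _ _ _ (~` measure_support Q)).
  - by apply: measurableC; exact: measurable_sphere_union.
  - by apply: open_Rn_measurable; exact: open_setC_support.
  - exact: subsetC.
  - exact: setC_support_null.
pose S j r : set (Rn R m.+3) := sphere (Defs.center R m.+3 j) r.
have mS j r : measurable (S j r) by exact: measurable_sphere.
have QS k : (2 <= k)%N -> Q (S k (r1 k)) = 0%E.
  move=> k2.
  pose F (j : option nat) : set (Rn R m.+3) := if j is Some j then
    (if (2 <= j)%N then S k (r1 k) `&` S j (r2 j) else set0)
    else ~` sphere_union r2.
  have mF j : measurable (F j).
    case: j => [j|] /=; last by apply: measurableC; exact: measurable_sphere_union.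
    by case: ifP => // _; exact: measurableI.
  have F0 j : Q (F j) = 0%E.
    case: j => [j|] //=; case: ifP => [j2|_]; last by rewrite measure0.
    apply: sphere_meet_null => //; [exact: r10|exact: r20|].
    by case=> kj; rewrite -kj => /eqP; apply/negP; exact: r12.
  apply: (subset_null _ _ _ (bigcup_count_null mF F0)) => //.
    by apply: countable_bigcupT_measurable => //; exact: countableP.
  move=> x Skx; have [[j /= j2 Sjx]|nx] := pselect (sphere_union r2 x).
    by exists (Some j) => //=; rewrite j2.
  by exists None.
have PS k : (2 <= k)%N -> P (S k (r1 k)) = 0%E.
  by move=> k2; rewrite (eq_sphere_measure PP QQ PQ0) ?r10//; exact: QS.
have : P (sphere_union r1) = 0%E.
  pose F j : set (Rn R m.+3) := if (2 <= j)%N then S j (r1 j) else set0.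
  have mF j : measurable (F j) by rewrite /F; case: ifP.
  have F0 j : P (F j) = 0%E.
    by rewrite /F; case: ifP => [/PS//|_]; rewrite measure0.
  apply: (subset_null _ _ _ (bigcup_count_null mF F0)).
  - exact: measurable_sphere_union.
  - by apply: countable_bigcupT_measurable => //; exact: countableP.
  - by move=> x [j /= j2 Sjx]; exists j => //; rewrite /F j2.
by rewrite P1 => /eqP; rewrite onee_eq0.
Qed.

(** * Measures of small energy difference *)

Lemma probability_image d d' (T : measurableType d) (T' : measurableType d')
    (R : realType) (P : probability T R) (f : T -> T') :
  measurable_fun setT f ->
  exists Q : probability T' R, (forall A, Q A = P (f @^-1` A)) /\
    (forall g : T' -> \bar R, measurable_fun setT g -> (forall y, (0 <= g y)%E) ->
       (\int[Q]_y g y = \int[P]_x g (f x))%E).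
Proof.
move=> mf; pose mfM := isMeasurableFun.Build _ _ _ _ f mf.
pose X : {mfun T >-> T'} := HB.pack f mfM.
exists (distribution P X); split => // g mg g0.
exact: ge0_integral_distribution.
Qed.

Definition box (R : realType) (d : nat) (v : 'rV[R]_d) (r : R) : set 'rV[R]_d :=
  [set u | forall i, `|u ord0 i - v ord0 i| <= r].

Lemma measurable_box (R : realType) (d : nat) (v : 'rV[R]_d) (r : R) :
  measurable (box v r : set (Rn R d)).
Proof.
rewrite (_ : box v r = \bigcap_(i in [set: 'I_d])
   (fun u : Rn R d => `|(u : 'rV[R]_d) ord0 i - v ord0 i|) @^-1` `]-oo, r]).
  apply: fin_bigcap_measurable => // i _; rewrite -[X in measurable X]setTI.
  have : measurable_fun setT (fun u : Rn R d => `|(u : 'rV[R]_d) ord0 i - v ord0 i|).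
    apply: measurableT_comp => //; apply: measurable_funB => //.
    exact: measurable_coord.
  by apply.
apply/seteqP; split => [u /= h i _ /=|u /= h i]; first by rewrite in_itv/=.
by have := h i I; rewrite /= in_itv.
Qed.

Lemma interval_distE (R : realType) (v r : R) :
  [set t | `|t - v| <= r] = `[v - r, v + r]%classic.
Proof. by apply/seteqP; split => t /=; rewrite in_itv/= ler_distl. Qed.

Lemma unit_interval_probability (R : realType) :
  exists U : probability (measurableTypeR R) R,
    U [set t | `|t - 2^-1| <= 2^-1] = 1%E /\
    forall v r : R, 0 <= r -> (U [set t | (`|t - v| <= r)%R] <= (2 * r)%:E)%E.
Proof.
have mI : measurable (`[0%R, 1%R]%classic : set (measurableTypeR R)) by [].
have I1 : lebesgue_measure (`[0%R, 1%R]%classic : set R) = 1%E.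
  by rewrite lebesgue_measure_itv/= lte_fin ltr01 oppr0 adde0.
have muT : mrestr (@lebesgue_measure R) mI setT = 1%E by rewrite /mrestr setTI.
have [U UE] := measure_probability muT.
have UA A : U A = lebesgue_measure (A `&` `[0%R, 1%R]%classic).
  by rewrite -[LHS]/((U : {measure set _ -> \bar R}) A) -UE.
exists U; split.
  by rewrite UA interval_distE subrr (_ : 2^-1 + 2^-1 = 1) ?setIid//; field.
move=> v r r0; rewrite UA interval_distE.
apply: (@le_trans _ _ (lebesgue_measure `[(v - r)%R, (v + r)%R]%classic)).
  by apply: le_measure; rewrite ?inE//; exact: measurableI.
rewrite lebesgue_measure_itv/=; case: ifPn => _.
  by rewrite -EFinD lee_fin; lra.
by rewrite lee_fin mulr_ge0.
Qed.

(** The uniform law on the unit cube, built one coordinate at a time: the preimage of a box is a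
    product, so the growth bounds multiply. *)
Lemma cube_probability (R : realType) (d : nat) :
  exists P : probability (Rn R d) R,
    P (box (const_mx 2^-1) 2^-1) = 1%E /\
    forall (v : 'rV[R]_d) (r : R), 0 <= r -> (P (box v r) <= ((2 * r) ^+ d)%:E)%E.
Proof.
elim: d => [|d [P [P1 Pb]]].
  exists (@dirac _ (Rn R 0) point R); split.
    rewrite (_ : box _ _ = setT); first exact: (@probability_setT _ (Rn R 0)).
    by apply/seteqP; split => // u _ [].
  by move=> v r _; rewrite expr0 probability_le1//; exact: measurable_box.
have [U [U1 Ub]] := unit_interval_probability R.
pose f (z : Rn R d * measurableTypeR R) : Rn R d.+1 :=
  \row_i (if unlift ord0 i is Some j then (z.1 : 'rV[R]_d) ord0 j else z.2).
have f0 z : (f z : 'rV[R]_d.+1) ord0 ord0 = z.2 by rewrite mxE unlift_none.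
have fS z j : (f z : 'rV[R]_d.+1) ord0 (lift ord0 j) = (z.1 : 'rV[R]_d) ord0 j.
  by rewrite mxE liftK.
have mf : measurable_fun setT f.
  apply: measurable_rV => i; case: (unliftP ord0 i) => [j ->|->].
    under eq_fun do rewrite fS.
    by apply: (measurableT_comp (@measurable_coord R d j)).
  by rewrite (funext f0); exact: measurable_snd.
have [Q [QE _]] := probability_image (P \x U)%E mf.
have Qbox (v : 'rV[R]_d.+1) r : Q (box v r) =
    (P (box (\row_j v ord0 (lift ord0 j)) r) *
     U [set t | (`|t - v ord0 ord0| <= r)%R])%E.
  rewrite QE (_ : f @^-1` _ = box (\row_j v ord0 (lift ord0 j)) r `*`
      [set t | `|t - v ord0 ord0| <= r]).
    apply: product_measure1E; first exact: measurable_box.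
    by rewrite interval_distE; exact: measurable_itv.
  apply/seteqP; split => z /=.
    move=> h; split => [j|]; last by have := h ord0; rewrite f0.
    by rewrite mxE; have := h (lift ord0 j); rewrite fS.
  move=> [h1 h2] i; case: (unliftP ord0 i) => [j ->|->]; last by rewrite f0.
  by have := h1 j; rewrite mxE fS.
exists Q; split.
  rewrite Qbox mxE U1 mule1 (_ : \row_j _ = const_mx 2^-1)//.
  by apply/rowP => j; rewrite !mxE.
move=> v r r0; rewrite Qbox exprSr EFinM lee_pmul//.
- exact: Pb.
- exact: Ub.
Qed.

Section sphere_chart.
Variables (R : realType) (m : nat).
Local Notation T := (Rn R m.+2).

Definition clamp (t : R) : R := Num.max 0 (Num.min 1 t).

Lemma clamp01 t : 0 <= clamp t <= 1.
Proof. by rewrite /clamp le_max lexx/= ge_max ler01 ge_min lexx. Qed.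

Lemma clamp_id t : 0 <= t <= 1 -> clamp t = t.
Proof.
by move=> /andP[t0 t1]; rewrite /clamp (min_idPr _)// (max_idPr _).
Qed.

(** Division by the number m + 2 of tail coordinates keeps the sum of their squares at most 1,
    leaving room for the coordinate that completes a unit vector. *)
Definition chart_tail (u : 'rV[R]_m.+2) (j : 'I_m.+2) : R :=
  clamp (u ord0 j) / m.+2%:R.

(* Clamping the coordinates keeps the graph inside the unit sphere for every
   [u], and changes nothing on the cube, which carries the whole mass. *)
Definition chart (u : 'rV[R]_m.+2) : 'rV[R]_m.+3 :=
  \row_i (if unlift ord0 i is Some j then chart_tail u j
          else Num.sqrt (1 - \sum_j chart_tail u j ^+ 2)).

Lemma chart0 u : chart u ord0 ord0 = Num.sqrt (1 - \sum_j chart_tail u j ^+ 2).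
Proof. by rewrite mxE unlift_none. Qed.

Lemma chartS u j : chart u ord0 (lift ord0 j) = chart_tail u j.
Proof. by rewrite mxE liftK. Qed.

Lemma chart_tail_sum u : \sum_j chart_tail u j ^+ 2 <= 1.
Proof.
apply: (@le_trans _ _ (\sum_(j < m.+2) m.+2%:R^-1)); last first.
  by rewrite sumr_const card_ord -[_ *+ _]mulr_natl mulfV// pnatr_eq0.
apply: ler_sum => j _; rewrite /chart_tail.
have /andP[c0 c1] := clamp01 (u ord0 j).
have i0 : 0 < m.+2%:R^-1 :> R by rewrite invr_gt0.
have i1 : m.+2%:R^-1 <= 1 :> R by rewrite invf_le1// ler1n.
rewrite exprMn -[leRHS]mul1r; apply: ler_pM; rewrite ?sqr_ge0//.
  by rewrite exprn_ile1.
by rewrite expr2 ler_piMl// ltW.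
Qed.

Lemma dist2_chart0 u : dist2 (chart u) 0 = 1.
Proof.
rewrite /dist2 big_ord_recl chart0 mxE subr0 sqr_sqrtr ?subr_ge0 ?chart_tail_sum//.
under [X in _ + X]eq_bigr do rewrite chartS mxE subr0.
by rewrite subrK.
Qed.

Lemma measurable_chart : measurable_fun setT (chart : T -> Rn R m.+3).
Proof.
have mt j : measurable_fun setT (fun u : T => chart_tail u j).
  apply: measurable_funM => //; apply: measurable_maxr => //.
  by apply: measurable_minr => //; exact: measurable_coord.
apply: measurable_rV => i; case: (unliftP ord0 i) => [j ->|->].
  by rewrite (funext (chartS^~ j)).
rewrite (funext chart0); apply: measurableT_comp.
  by apply: continuous_measurable_fun; exact: sqrt_continuous.
apply: measurable_funB => //; apply: measurable_sum => j.
exact: measurable_funX.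
Qed.

(** A point of the graph is at least as far from y as its tail is from the tail of y, and the tail
    is the cube variable divided by m + 2. The preimage of a ball of radius r therefore lies, up to
    a null set, in a box of radius (m + 2) r; the exponent is the dimension of the sphere. *)
Lemma sphere_chart_probability :
  exists P : probability T R, forall (y : 'rV[R]_m.+3) (r : R), 0 <= r ->
   (P [set u | (dist2 (chart u) y <= r ^+ 2)%R] <= ((2 * (m.+2%:R * r)) ^+ m.+2)%:E)%E.
Proof.
have [P [P1 Pb]] := cube_probability R m.+2; exists P => y r r0.
pose v : 'rV[R]_m.+2 := \row_j (m.+2%:R * y ord0 (lift ord0 j)).
have mr0 : 0 <= m.+2%:R * r by rewrite mulr_ge0.
apply: le_trans (Pb v _ mr0).
pose Q : set T := box (const_mx 2^-1) 2^-1.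
have mQ : measurable Q by exact: measurable_box.
have mv : measurable (box v (m.+2%:R * r) : set T) by exact: measurable_box.
have QC : P (~` Q) = 0%E.
  by have := probability_setC P mQ; rewrite [P Q]P1 subee.
apply: (@le_trans _ _ (P (box v (m.+2%:R * r) `|` ~` Q))).
  apply: le_measure; rewrite ?inE.
  - have md : measurable_fun setT (fun u : T => dist2 (chart u) y).
      apply: (@measurable_dist2 _ T R m.+3) => //; exact: measurable_chart.
    rewrite -[X in measurable X]setTI.
    rewrite (_ : [set u | _] = (fun u : T => dist2 (chart u) y) @^-1` `]-oo, r ^+ 2]).
      exact: md.
    by apply/seteqP; split => u; rewrite /= in_itv.
  - by apply: measurableU => //; exact: measurableC.
  - move=> u /= h; have [Qu|] := pselect (Q u); [left|by right].
    move=> j; rewrite mxE.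
    have /clamp_id cu : 0 <= u ord0 j <= 1.
      by have := Qu j; rewrite mxE ler_distl; lra.
    have : (chart_tail u j - y ord0 (lift ord0 j)) ^+ 2 <= r ^+ 2.
      apply: le_trans h; rewrite /dist2 (bigD1 (lift ord0 j))//= chartS lerDl.
      by apply: sumr_ge0 => i _; exact: sqr_ge0.
    rewrite -ler_sqrt ?sqr_ge0// !sqrtr_sqr (ger0_norm r0) /chart_tail cu => hr.
    have -> : u ord0 j - m.+2%:R * y ord0 (lift ord0 j) =
      m.+2%:R * (u ord0 j / m.+2%:R - y ord0 (lift ord0 j)).
      by rewrite mulrBr (mulrCA _ (u ord0 j)) mulfV ?mulr1// pnatr_eq0.
    by rewrite normrM ger0_norm// ler_wpM2l.
rewrite -[leRHS]adde0 -QC; apply: measureU2 => //.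
exact: measurableC.
Qed.

End sphere_chart.

(** * Riesz potentials of measures of power growth *)

Lemma geometric_sum_le (R : realType) (a q : R) (N : nat) : 0 <= a -> 0 <= q < 1 ->
  \sum_(0 <= j < N) a * q ^+ j <= a / (1 - q).
Proof.
move=> a0 /andP[q0 q1]; rewrite -mulr_sumr ler_wpM2l// big_mkord.
have d0 : 0 < 1 - q by rewrite subr_gt0.
rewrite -[leRHS]mul1r ler_pdivlMr// mulrC.
have <- : 1 - q ^+ N = (1 - q) * \sum_(j < N) q ^+ j.
  by rewrite -opprB subrX1 -mulNr opprB.
by rewrite gerBl exprn_ge0.
Qed.

Lemma powR_ge1 (R : realType) (a b : R) : 1 <= a -> 0 <= b -> 1 <= a `^ b.
Proof.
move=> a1 b0; apply: (@le_trans _ _ (1 `^ b)); first by rewrite powR1.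
apply: ge0_ler_powR => //; rewrite ?nnegrE//.
exact: le_trans a1.
Qed.

Section riesz.
Variable R : realType.

Definition riesz (n : nat) (b : R) (x y : 'rV[R]_n) : \bar R :=
  if dist2 x y == 0 then +oo%E else (Num.sqrt (dist2 x y) `^ (- b))%:E.

Lemma riesz_ge0 n b (x y : 'rV[R]_n) : (0 <= riesz b x y)%E.
Proof. by rewrite /riesz; case: ifP => // _; rewrite lee_fin powR_ge0. Qed.

Lemma measurable_riesz d (T : measurableType d) n b (f g : T -> Rn R n) :
  measurable_fun setT f -> measurable_fun setT g ->
  measurable_fun setT (fun t => riesz b (f t : 'rV[R]_n) (g t)).
Proof.
move=> mf mg; have md := measurable_dist2 mf mg.
apply: measurable_fun_ifT => //; first exact: measurable_fun_eqr.
apply/measurable_EFinP.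
apply: (@measurableT_comp _ _ _ _ _ _ (fun r : R => r `^ (- b))).
  exact: measurable_powR.
apply: measurableT_comp => //.
by apply: continuous_measurable_fun; exact: sqrt_continuous.
Qed.

(** The constant 1 takes care of distances at least 1; for a distance in the shell from 2^(-j-1) to
    2^(-j) the j-th term alone suffices; on the diagonal all terms are at least 1 and the series
    diverges. *)
Lemma riesz_le_dyadic n b (x y : 'rV[R]_n) : 0 < b ->
  (riesz b x y <= 1 + \sum_(j <oo)
    ((2 `^ b) ^+ j.+1 * (dist2 x y <= (2^-1 ^+ j) ^+ 2)%R%:R)%:E)%E.
Proof.
move=> b0.
have B1 : 1 <= 2 `^ b :> R by apply: powR_ge1; rewrite ?ler1n ?ltW.
pose f j : \bar R :=
  ((2 `^ b) ^+ j.+1 * (dist2 x y <= (2^-1 ^+ j) ^+ 2)%R%:R)%:E.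
rewrite -/f.
have f0 j : (0 <= f j)%E by rewrite lee_fin mulr_ge0 ?ler0n// exprn_ge0// powR_ge0.
have S0 : (0 <= \sum_(j <oo) f j)%E by exact: nneseries_ge0.
have fS j : (f j <= \sum_(j <oo) f j)%E.
  apply: (@le_trans _ _ (\sum_(0 <= i < j.+1) f i)%E).
    by rewrite big_nat_recr//= leeDr// sume_ge0.
  exact: nneseries_lim_ge.
rewrite /riesz; case: ifPn => [/eqP d0|d0].
  have fge j : (1 <= f j)%E.
    by rewrite lee_fin d0 sqr_ge0 mulr1 exprn_ege1.
  suff -> : (\sum_(j <oo) f j = +oo)%E by rewrite addey.
  apply/eqyP => A A0.
  apply: (@le_trans _ _ (\sum_(0 <= i < (Num.truncn A).+1) f i)%E); last first.
    exact: nneseries_lim_ge.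
  apply: (@le_trans _ _ (\sum_(0 <= i < (Num.truncn A).+1) 1%E)%E); last first.
    exact: lee_sum.
  rewrite sumEFin lee_fin big_const_nat subn0 iter_addr_0 ltW//.
  exact: truncnS_gt.
set l := Num.sqrt (dist2 x y).
have l0 : 0 < l by rewrite sqrtr_gt0 lt_neqAle eq_sym d0 dist2_ge0.
have lE : l ^+ 2 = dist2 x y by rewrite sqr_sqrtr// dist2_ge0.
have [l1|l1] := leP 1 l.
  apply: (@le_trans _ _ 1%E); last by rewrite leeDl.
  by rewrite lee_fin powRN invf_le1 ?powR_gt0// powR_ge1// ltW.
have [k hk] : exists k, 1 < 2 ^+ k.+1 * l.
  have [N _ /(_ N (leqnn N))/= hN] := near_infty_natSinv_expn_lt (PosNum l0).
  exists N; rewrite exprS -mulrA; move: hN; rewrite div1r => hN.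
  have : 1 < 2 ^+ N * l by rewrite -ltr_pdivrMl ?exprn_gt0// mulr1.
  by lra.
(* The least j with 2^(-j-1) < l; minimality gives l <= 2^(-j), so j is the index of the dyadic
   shell. *)
have [j hj jmin] := ex_minnP (ex_intro (fun k => 1 < 2 ^+ k.+1 * l) k hk).
have lj : l <= 2^-1 ^+ j.
  case: j jmin {hj} => [|j] jmin; first by rewrite expr0 ltW.
  rewrite leNgt; apply/negP => lj.
  have h : 1 < 2 ^+ j.+1 * l by rewrite -ltr_pdivrMl ?exprn_gt0// mulr1 -exprVn.
  by have := jmin _ h; rewrite ltnn.
apply: (@le_trans _ _ (f j)); last by apply: (le_trans (fS j)); rewrite leeDr.
rewrite lee_fin -lE lerXn2r ?nnegrE ?exprn_ge0 ?invr_ge0 ?(ltW l0)// mulr1.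
rewrite powRN -[leLHS]mul1r ler_pdivrMr ?powR_gt0//.
have powX i : (2 `^ b) ^+ i = (2 ^+ i) `^ b :> R.
  by elim: i => [|i IH]; rewrite ?expr0 ?powR1// !exprS powRM// ?exprn_ge0// IH.
rewrite powX -powRM ?exprn_ge0 ?(ltW l0)//.
by apply: powR_ge1; exact: ltW.
Qed.

End riesz.

Lemma riesz_potential_bound d (T : measurableType d) (R : realType) (n D : nat)
    (P : probability T R) (f : T -> Rn R n) (C b : R) :
  measurable_fun setT f -> 0 <= C -> 0 < b < D%:R ->
  (forall (y : 'rV[R]_n) (r : R), 0 <= r ->
    (P [set u | (dist2 (f u : 'rV[R]_n) y <= r ^+ 2)%R] <= ((C * r) ^+ D)%:E)%E) ->
  exists M : R, 0 <= M /\
    forall y : 'rV[R]_n, (\int[P]_u riesz b (f u : 'rV[R]_n) y <= M%:E)%E.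
Proof.
move=> mf C0 /andP[b0 bD] growth.
(* Integrating the dyadic bound against the growth of P gives the geometric series of terms a q^j.
   Its ratio q = 2^(b - D) is below 1 because b < D. *)
pose B : R := 2 `^ b; pose q : R := B * 2^-1 ^+ D; pose a := B * C ^+ D.
have B0 : 0 < B by rewrite powR_gt0.
have a0 : 0 <= a by rewrite mulr_ge0 ?exprn_ge0// ltW.
have q01 : 0 <= q < 1.
  rewrite mulr_ge0 ?exprn_ge0 ?invr_ge0// ?(ltW B0)//= /q exprVn ltr_pdivrMr ?exprn_gt0//.
  rewrite mul1r -powR_mulrn// /B /powR pnatr_eq0/= ltr_expR ltr_pM2r//.
  by rewrite ln_gt0// ltr1n.
exists (1 + a / (1 - q)); split.
  by rewrite addr_ge0// divr_ge0// subr_ge0; case/andP: q01 => _ /ltW.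
move=> y.
pose S j : set T := [set u | dist2 (f u : 'rV[R]_n) y <= (2^-1 ^+ j) ^+ 2].
have md : measurable_fun setT (fun u : T => dist2 (f u : 'rV[R]_n) y).
  by apply: (@measurable_dist2 _ T R n).
have mS j : measurable (S j).
  rewrite -[X in measurable X]setTI.
  rewrite (_ : S j = (fun u : T => dist2 (f u : 'rV[R]_n) y) @^-1`
    `]-oo, (2^-1 ^+ j) ^+ 2]).
    exact: md.
  by apply/seteqP; split => u; rewrite /= in_itv.
pose g j (u : T) : \bar R := (B ^+ j.+1 * \1_(S j) u)%:E.
have Bj j : 0 <= B ^+ j.+1 by rewrite exprn_ge0// ltW.
have g0 j u : (0 <= g j u)%E by rewrite lee_fin mulr_ge0.
have mg j : measurable_fun setT (g j).
  by apply/measurable_EFinP; apply: measurable_funM => //; exact: measurable_indic.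
have ig j : (\int[P]_u g j u <= (a * q ^+ j)%:E)%E.
  rewrite /g; under eq_integral do rewrite EFinM.
  rewrite ge0_integralZl; [|by []| |by move=> u _; rewrite lee_fin|by rewrite lee_fin];
    last by apply/measurable_EFinP; exact: measurable_indic.
  rewrite integral_indicT//.
  apply: (@le_trans _ _ ((B ^+ j.+1)%:E * ((C * 2^-1 ^+ j) ^+ D)%:E)%E).
    by rewrite lee_wpmul2l ?lee_fin//; apply: growth; rewrite exprn_ge0.
  rewrite -EFinM lee_fin /a /q exprS !exprMn -!exprM (mulnC j D) le_eqVlt.
  by apply/orP; left; apply/eqP; ring.
apply: (@le_trans _ _ (\int[P]_u (1 + \sum_(j <oo) g j u))%E).
  apply: ge0_le_integral => //.
  - by move=> u _; exact: riesz_ge0.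
  - by apply: (@measurable_riesz R _ T n).
  - apply: emeasurable_funD => //.
    by apply: ge0_emeasurable_sum => // j u _ _; exact: g0.
  - move=> u _; apply: le_trans (riesz_le_dyadic _ _ b0) _.
    rewrite leeD2l// (_ : (\sum_(j <oo) _ = \sum_(j <oo) g j u)%E)//.
    apply: eq_eseriesr => j _; rewrite /g indicE.
    rewrite (_ : (u \in S j) = (dist2 (f u : 'rV[R]_n) y <= (2^-1 ^+ j) ^+ 2))//.
    by apply/idP/idP => [/set_mem//|h]; exact: mem_set.
rewrite ge0_integralD//; last first.
- by apply: ge0_emeasurable_sum => // j u _ _; exact: g0.
- by move=> u _; exact: nneseries_ge0.
rewrite integral_nneseries//.
have -> : (\int[P]_u 1 = 1)%E.
  by rewrite (integral_cst P measurableT 1%E) mul1e; exact: probability_setT.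
rewrite EFinD leeD2l//; apply: lime_le.
  by apply: is_cvg_nneseries => j _ _; apply: integral_ge0 => u _; exact: g0.
apply: nearW => N; apply: (@le_trans _ _ (\sum_(0 <= j < N) (a * q ^+ j)%:E)%E).
  by apply: lee_sum => j _; exact: ig.
by rewrite sumEFin lee_fin geometric_sum_le.
Qed.

(* Interpolation between [l ^ (- p) - (l + h) ^ (- p) <= l ^ (- p)] and
   [l ^ (- p) - (l + h) ^ (- p) <= p h l ^ (- p - 1)] with [p = m + 1]. *)
Lemma newton_le_shift_riesz (R : realType) (m : nat) (h eta : R)
    (x y : 'rV[R]_m.+3) : 0 < h -> 0 < eta <= 1 ->
  (newton_kernel x y <=
   (((Num.sqrt (dist2 x y) + h) ^+ m.+1)^-1)%:E +
   (m.+1%:R * h `^ eta)%:E * riesz (m.+1%:R + eta) x y)%E.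
Proof.
move=> h0 /andP[e0 e1]; rewrite newton_kernelE /riesz; case: ifPn => [_|d0].
  rewrite gt0_muley ?addey ?leey//.
  by rewrite lte_fin mulr_gt0// powR_gt0.
set l := Num.sqrt (dist2 x y).
have l0 : 0 < l by rewrite sqrtr_gt0 lt_neqAle eq_sym d0 dist2_ge0.
rewrite -EFinM -EFinD lee_fin.
(* By homogeneity the claim becomes 1 <= (1 + t)^(-(m+1)) + (m+1) t^eta. For t >= 1 the last term
   suffices; for t < 1 one has t <= t^eta. *)
pose t := h / l; have t0 : 0 < t by rewrite divr_gt0.
have -> : h `^ eta = t `^ eta * l `^ eta.
  by rewrite -powRM ?(ltW t0) ?(ltW l0)// /t divfK ?gt_eqF.
have -> : l `^ (- (m.+1%:R + eta)) = (l ^+ m.+1)^-1 * (l `^ eta)^-1.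
  by rewrite powRN powRD ?powR_mulrn ?invfM ?(ltW l0)// (gt_eqF l0) implybT.
have -> : m.+1%:R * (t `^ eta * l `^ eta) * ((l ^+ m.+1)^-1 * (l `^ eta)^-1) =
   (l ^+ m.+1)^-1 * (m.+1%:R * t `^ eta).
  by field; rewrite !gt_eqF ?powR_gt0// exprn_gt0.
have -> : (l + h) ^+ m.+1 = l ^+ m.+1 * (1 + t) ^+ m.+1.
  by rewrite -exprMn mulrDr mulr1 /t mulrCA mulfV ?mulr1// gt_eqF.
rewrite invfM -mulrDr ler_peMr ?invr_ge0 ?exprn_ge0 ?(ltW l0)//.
have tn : 0 <= t `^ eta by exact: powR_ge0.
have [t1|t1] := leP 1 t.
  have : 1 <= t `^ eta by apply: powR_ge1; rewrite // ltW.
  have m1 : 1 <= m.+1%:R :> R by rewrite ler1n.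
  have : 0 <= ((1 + t) ^+ m.+1)^-1 by rewrite invr_ge0 exprn_ge0// addr_ge0// ltW.
  by nra.
have tt : t <= t `^ eta.
  rewrite -[leLHS]powRr1 ?(ltW t0)//; apply: ger_powR => //.
  by rewrite t0 ltW.
(* Bernoulli's inequality for 1 - t, combined with 1 - t <= 1 / (1 + t). *)
have bern : 1 - m.+1%:R * t <= ((1 + t) ^+ m.+1)^-1.
  apply: (@le_trans _ _ ((1 - t) ^+ m.+1)).
    elim: m.+1 => [|N IH]; first by rewrite expr0 mul0r subr0.
    rewrite exprS -natr1; have N0 : 0 <= N%:R :> R by [].
    have t1' : 0 <= 1 - t by rewrite subr_ge0 ltW.
    have Ntt : 0 <= N%:R * (t * t) by rewrite mulr_ge0// mulr_ge0// ltW.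
    apply: le_trans (ler_wpM2l t1' IH); rewrite -subr_ge0.
    by rewrite (_ : _ - _ = N%:R * (t * t))//; ring.
  rewrite -exprVn lerXn2r ?nnegrE ?invr_ge0 ?subr_ge0 ?addr_ge0 ?(ltW t1) ?(ltW t0)//.
  rewrite -[leRHS]mul1r ler_pdivlMr ?addr_gt0//.
  have tt0 : 0 <= t * t by rewrite mulr_ge0// ltW.
  by rewrite -subr_ge0 (_ : _ - _ = t * t)//; ring.
apply: (le_trans _ (lerD bern (lexx _))).
by have := ler_wpM2l (ler0n R m.+1) tt; lra.
Qed.

(** * One measure carried to two concentric spheres *)

Lemma sphere_open_setC (R : realType) (n : nat) (x : 'rV[R]_n) (r : R) :
  0 <= r -> open (~` sphere x r).
Proof.
move=> r0; apply: closed_openC.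
rewrite (_ : sphere x r = (fun y => dist2 y x) @^-1` [set r ^+ 2]); last first.
  by apply/seteqP; split => y /(sphereE _ _ r0).
have cont : continuous (fun y : 'rV[R]_n => dist2 y x).
  move=> y; have FF : Filter (nbhs y) by exact: nbhs_filter.
  apply: cvg_big => [|i _]; first exact: add_continuous.
  have cv : y' ord0 i - x ord0 i @[y' --> y] --> y ord0 i - x ord0 i.
    by apply: cvgB; [exact: coord_continuous|exact: cvg_cst].
  by rewrite expr2; under eq_fun do rewrite expr2; exact: cvgM.
apply: closed_comp; last exact: closed_eq.
by move=> y _; exact: cont.
Qed.

Lemma admissible_image (R : realType) (n : nat) d (T : measurableType d)
    (P : probability T R) (f : T -> Rn R n) (Q : probability (Rn R n) R)
    (A : set (Rn R n)) (x : 'rV[R]_n) (r : R) :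
  measurable_fun setT f -> (forall B, Q B = P (f @^-1` B)) ->
  0 <= r -> (forall u, sphere x r (f u)) -> measurable A -> sphere x r `<=` A ->
  (mutual_energy Q Q < +oo)%E -> admissible A Q.
Proof.
move=> mf QE r0 fS mA SA fin; split => //.
- move=> K cK; apply: le_lt_trans (ltry 1).
  apply: probability_le1; rewrite -(setCK K); apply: measurableC.
  apply: open_Rn_measurable; apply: closed_openC.
  by apply: compact_closed => //; exact: norm_hausdorff.
- move=> y Sy; apply: contrapT => nAy.
  have := Sy (~` sphere x r) (sphere_open_setC r0) (fun h => nAy (SA _ h)).
  have Q0 : Q (~` sphere x r) = 0%E.
    rewrite QE (_ : f @^-1` _ = set0) ?measure0//.
    by rewrite -subset0 => u /=; apply; exact: fS.
  by rewrite [X in (0 < X)%E]Q0 ltxx.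
- have Q1 : Q A = 1%E.
    rewrite QE (_ : f @^-1` _ = setT); first exact: probability_setT.
    by apply/seteqP; split => // u _; exact/SA/fS.
  exact: Q1.
Qed.

(** Self and mutual energies of images of P all become integrals over the one space [P \x P], where
    the kernels can be compared pointwise. *)
Lemma mutual_energy_image (R : realType) (m : nat) d (T : measurableType d)
    (P : probability T R) (f1 f2 : T -> Rn R m.+3)
    (Q1 Q2 : probability (Rn R m.+3) R) :
  measurable_fun setT f1 -> measurable_fun setT f2 ->
  (forall g : Rn R m.+3 -> \bar R, measurable_fun setT g -> (forall y, (0 <= g y)%E) ->
     (\int[Q1]_y g y = \int[P]_x g (f1 x))%E) ->
  (forall g : Rn R m.+3 -> \bar R, measurable_fun setT g -> (forall y, (0 <= g y)%E) ->
     (\int[Q2]_y g y = \int[P]_x g (f2 x))%E) ->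
  mutual_energy Q1 Q2 =
  (\int[P \x P]_z newton_kernel (f1 z.1 : 'rV[R]_m.+3) (f2 z.2))%E.
Proof.
move=> mf1 mf2 I1 I2; rewrite /mutual_energy I1; first last.
- by move=> x; apply: integral_ge0 => y _; exact: newton_kernel_ge0.
- apply: (@measurable_fun_fubini_tonelli_F _ _ (Rn R m.+3) (Rn R m.+3) R Q2
    (fun z => newton_kernel (z.1 : 'rV[R]_m.+3) z.2)).
  + exact: measurable_newton_kernel.
  + by move=> z; exact: newton_kernel_ge0.
rewrite (@fubini_tonelli1 _ _ T T R P P); first last.
- by move=> z; exact: newton_kernel_ge0.
- by apply: measurable_newton_kernel; exact: measurableT_comp.
apply: eq_integral => u _; rewrite I2//.
- by apply: (@measurable_newton_kernel _ (Rn R m.+3)).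
- by move=> y; exact: newton_kernel_ge0.
Qed.

Section dilation.
Variables (R : realType) (n : nat) (c : 'rV[R]_n).

Definition dilate (r : R) (x : 'rV[R]_n) : 'rV[R]_n := c + r *: x.

Lemma dist2_dilate r x y : dist2 (dilate r x) (dilate r y) = r ^+ 2 * dist2 x y.
Proof. by rewrite /dist2 mulr_sumr; apply: eq_bigr => i _; rewrite !mxE; ring. Qed.

Lemma dist2_dilate_center r x : dist2 (dilate r x) c = r ^+ 2 * dist2 x 0.
Proof. by rewrite /dist2 mulr_sumr; apply: eq_bigr => i _; rewrite !mxE; ring. Qed.

(** With s the inner product of the unit vectors x and y, the right-hand side minus the left-hand
    side is 2 r2 (r2 - r1) (1 - s). *)
Lemma dist2_dilate2 (r1 r2 : R) x y : 0 <= r1 <= r2 ->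
  dist2 x 0 = 1 -> dist2 y 0 = 1 ->
  dist2 (dilate r1 x) (dilate r2 y) <= r2 ^+ 2 * dist2 x y + (r2 - r1) ^+ 2.
Proof.
move=> /andP[r10 r12] x1 y1.
pose s := \sum_i x ord0 i * y ord0 i.
have dE : dist2 x y = 2 - 2 * s.
  rewrite (_ : 2 - 2 * s = dist2 x 0 + dist2 y 0 - 2 * s); last by rewrite x1 y1; ring.
  rewrite /dist2 /s mulr_sumr -big_split -sumrB/=.
  by apply: eq_bigr => i _; rewrite !mxE; ring.
have -> : dist2 (dilate r1 x) (dilate r2 y) = r1 ^+ 2 + r2 ^+ 2 - 2 * r1 * r2 * s.
  rewrite (_ : r1 ^+ 2 + r2 ^+ 2 - 2 * r1 * r2 * s =
    r1 ^+ 2 * dist2 x 0 + r2 ^+ 2 * dist2 y 0 - 2 * r1 * r2 * s); last first.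
    by rewrite x1 y1; ring.
  rewrite /dist2 /s !mulr_sumr -big_split -sumrB/=.
  by apply: eq_bigr => i _; rewrite !mxE; ring.
have s1 : 0 <= 1 - s by have := dist2_ge0 x y; rewrite dE; lra.
rewrite dE -subr_ge0.
have -> : r2 ^+ 2 * (2 - 2 * s) + (r2 - r1) ^+ 2 -
   (r1 ^+ 2 + r2 ^+ 2 - 2 * r1 * r2 * s) = 2 * r2 * (r2 - r1) * (1 - s) by ring.
rewrite mulr_ge0// mulr_ge0 ?subr_ge0// mulr_ge0//.
exact: le_trans r12.
Qed.

Lemma measurable_dilate d (T : measurableType d) (f : T -> Rn R n) r :
  measurable_fun setT f -> measurable_fun setT (fun u => dilate r (f u) : Rn R n).
Proof.
move=> mf; apply: measurable_rV => i.
have mi : measurable_fun setT (fun u => c ord0 i + r * (f u : 'rV[R]_n) ord0 i).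
  apply: measurable_funD => //; apply: measurable_funM => //.
  exact: (measurableT_comp (@measurable_coord R n i) mf).
by apply: eq_measurable_fun mi => u _; rewrite !mxE.
Qed.

End dilation.

Lemma newton_dilate (R : realType) (m : nat) (c : 'rV[R]_m.+3) (r : R) x y : 0 < r ->
  newton_kernel (dilate c r x) (dilate c r y) =
  (((r ^+ m.+1)^-1)%:E * newton_kernel x y)%E.
Proof.
move=> r0; rewrite !newton_kernelE dist2_dilate mulf_eq0 sqrf_eq0 (gt_eqF r0)/=.
case: ifPn => [_|d0]; first by rewrite gt0_muley// lte_fin invr_gt0 exprn_gt0.
by rewrite sqrtrM ?sqr_ge0// sqrtr_sqr gtr0_norm// exprMn invfM EFinM.
Qed.

(** The points on the two spheres are at distance at most r2 (|x - y| + h) with h = 1 - r1 / r2. The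
    lower bound is the kernel of the sphere of radius r2 with its distance shifted by h, which
    [newton_le_shift_riesz] compares with the unshifted one. *)
Lemma newton_dilate2_ge (R : realType) (m : nat) (c : 'rV[R]_m.+3) (r1 r2 : R) x y :
  0 < r1 < r2 -> dist2 x 0 = 1 -> dist2 y 0 = 1 ->
  (((r2 ^+ m.+1)^-1 * ((Num.sqrt (dist2 x y) + (1 - r1 / r2)) ^+ m.+1)^-1)%:E <=
  newton_kernel (dilate c r1 x) (dilate c r2 y))%E.
Proof.
move=> /andP[r10 r12] x1 y1; have r20 := lt_trans r10 r12.
rewrite newton_kernelE; case: ifPn => [_|d0]; first exact: leey.
have h0 : 0 < 1 - r1 / r2 by rewrite subr_gt0 ltr_pdivrMr// mul1r.
set l := Num.sqrt (dist2 x y); have l0 : 0 <= l by exact: sqrtr_ge0.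
have D0 : 0 < Num.sqrt (dist2 (dilate c r1 x) (dilate c r2 y)).
  by rewrite sqrtr_gt0 lt_neqAle eq_sym d0 dist2_ge0.
have lh0 : 0 < l + (1 - r1 / r2) by exact: ltr_wpDl.
rewrite lee_fin -invfM lef_pV2 ?posrE ?mulr_gt0 ?exprn_gt0//.
have rl0 : 0 <= r2 * (l + (1 - r1 / r2)) by rewrite mulr_ge0// ltW.
rewrite -exprMn; apply: lerXn2r; rewrite ?nnegrE ?(ltW D0)//.
rewrite -[leRHS]ger0_norm// -sqrtr_sqr ler_sqrt ?sqr_ge0//.
have r1r2 : 0 <= r1 <= r2 by rewrite (ltW r10) (ltW r12).
apply: (le_trans (dist2_dilate2 c r1r2 x1 y1)).
have -> : r2 * (l + (1 - r1 / r2)) = r2 * l + (r2 - r1).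
  by field; rewrite gt_eqF.
rewrite -(sqr_sqrtr (dist2_ge0 x y)) -/l -exprMn [leRHS]sqrrD lerD2r lerDl.
by rewrite mulrn_wge0// mulr_ge0 ?subr_ge0 ?(ltW r12)// mulr_ge0// ltW.
Qed.

Section near_optimal.
Variables (R : realType) (m : nat) (eta : R).
Hypothesis eta01 : 0 < eta < 1.
Local Notation T := (Rn R m.+2).

(** Let E be the energy of the measure on the unit sphere, W its energy for the kernel shifted by h
    = 1 - r1 / r2, and A_i the inverse of r_i^(m+1). The self energies are A_i E and the mutual
    energy is at least A_2 W, so the difference is at most (A_1 - A_2) E + 2 A_2 (E - W), with E - W
    <= C h^eta. All pairs are dilations of one measure, so e and C are chosen before the spheres. *)
Lemma near_optimal_pair : exists e C : R, forall (c : 'rV[R]_m.+3) (r1 r2 : R),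
  0 < r1 < r2 ->
  exists Q1 Q2 : probability (Rn R m.+3) R,
  [/\ forall A : set (Rn R m.+3), measurable A -> sphere c r1 `<=` A -> admissible A Q1,
      forall A : set (Rn R m.+3), measurable A -> sphere c r2 `<=` A -> admissible A Q2 &
      (energy_diff Q1 Q2 <= (((r1 ^+ m.+1)^-1 - (r2 ^+ m.+1)^-1) * e +
        2 * ((r2 ^+ m.+1)^-1 * (C * (1 - r1 / r2) `^ eta)))%:E)%E].
Proof.
have /andP[eta0 eta1] := eta01.
have [P growth] := sphere_chart_probability R m.
have mc := @measurable_chart R m.
have growth' (y : 'rV[R]_m.+3) (r : R) : 0 <= r ->
    (P [set u | (dist2 (chart u) y <= r ^+ 2)%R] <= ((2 * m.+2%:R * r) ^+ m.+2)%:E)%E.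
  by rewrite -mulrA; exact: growth.
have C0 : 0 <= 2 * m.+2%:R :> R by rewrite mulr_ge0.
have bD : 0 < m.+1%:R + eta < m.+2%:R by rewrite ltr_wpDl//= -[in ltRHS]natr1 ltrD2l.
have [M [M0 hM]] := riesz_potential_bound mc C0 bD growth'.
pose ch (u : T) : 'rV[R]_m.+3 := chart u.
pose K (z : T * T) := newton_kernel (ch z.1) (ch z.2).
pose w h (z : T * T) : R := ((Num.sqrt (dist2 (ch z.1) (ch z.2)) + h) ^+ m.+1)^-1.
pose rz (z : T * T) := riesz (m.+1%:R + eta) (ch z.1) (ch z.2).
have mch1 : measurable_fun setT (fun z : T * T => ch z.1 : Rn R m.+3).
  exact: (measurableT_comp mc).
have mch2 : measurable_fun setT (fun z : T * T => ch z.2 : Rn R m.+3).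
  exact: (measurableT_comp mc).
have mK : measurable_fun setT K by exact: measurable_newton_kernel.
have mrz : measurable_fun setT rz by exact: measurable_riesz.
have w0 h z : 0 < h -> 0 <= w h z.
  by move=> h0; rewrite invr_ge0 exprn_ge0// addr_ge0 ?sqrtr_ge0// ltW.
have mw h : 0 < h -> measurable_fun setT (fun z => (w h z)%:E).
  move=> h0; apply/measurable_EFinP.
  rewrite (_ : w h = (fun z =>
      ((Num.sqrt (dist2 (ch z.1) (ch z.2)) + h) ^+ m.+1) `^ (-1))).
    apply: (@measurableT_comp _ _ _ _ _ _ (fun r : R => r `^ (-1))).
      exact: measurable_powR.
    apply: measurable_funX; apply: measurable_funD => //.
    apply: measurableT_comp; first by apply: continuous_measurable_fun; exact: sqrt_continuous.
    exact: measurable_dist2.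
  by apply/funext => z; rewrite powR_inv1// exprn_ge0// addr_ge0 ?sqrtr_ge0// ltW.
have K0 z : (0 <= K z)%E by exact: newton_kernel_ge0.
pose E := (\int[P \x P]_z K z)%E.
pose W h := (\int[P \x P]_z (w h z)%:E)%E.
have i1 (r : R) : (\int[P \x P]_z r%:E = r%:E)%E.
  rewrite (integral_cst (P \x P)%E measurableT r%:E).
  rewrite [X in (_ * X)%E](_ : _ = 1%E) ?mule1//.
  exact: (@probability_setT _ (T * T)%type R (P \x P)%E).
have rzM : (\int[P \x P]_z rz z <= M%:E)%E.
  rewrite (@fubini_tonelli1 _ _ T T R P P)//; last by move=> z; exact: riesz_ge0.
  apply: (@le_trans _ _ (\int[P]_u M%:E)%E).
    apply: ge0_le_integral => //.
    - by move=> u _; apply: integral_ge0 => v _; exact: riesz_ge0.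
    - by apply: (measurable_fun_fubini_tonelli_F rz) => // z; exact: riesz_ge0.
    - move=> u _; apply: le_trans (hM (ch u)); rewrite le_eqVlt; apply/orP; left.
      by apply/eqP; apply: eq_integral => v _; rewrite /rz /riesz dist2C.
  rewrite (integral_cst P measurableT M%:E).
  by rewrite [X in (_ * X)%E](_ : _ = 1%E) ?mule1//; exact: probability_setT.
have W0 h : 0 < h -> (0 <= W h)%E.
  by move=> h0; apply: integral_ge0 => z _; rewrite lee_fin w0.
have Wfin h : 0 < h -> W h \is a fin_num.
  move=> h0; rewrite ge0_fin_numE ?W0//.
  apply: (@le_lt_trans _ _ (\int[P \x P]_z ((h ^+ m.+1)^-1)%:E)%E); last first.
    by rewrite i1 ltry.
  apply: ge0_le_integral => //.
  - by move=> z _; rewrite lee_fin w0.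
  - exact: mw.
  - move=> z _; rewrite lee_fin lef_pV2 ?posrE ?exprn_gt0 ?ltr_wpDl ?sqrtr_ge0//.
    by apply: lerXn2r; rewrite ?nnegrE ?addr_ge0 ?sqrtr_ge0 ?(ltW h0)// lerDr sqrtr_ge0.
have key h : 0 < h -> (E <= W h + (m.+1%:R * h `^ eta * M)%:E)%E.
  move=> h0.
  apply: (@le_trans _ _ (\int[P \x P]_z ((w h z)%:E + (m.+1%:R * h `^ eta)%:E * rz z))%E).
    apply: ge0_le_integral => //.
    - apply: emeasurable_funD; first exact: mw.
      by apply: emeasurable_funM.
    - by move=> z _; apply: newton_le_shift_riesz => //; rewrite eta0 ltW.
  have c0 : (0 <= (m.+1%:R * h `^ eta)%:E)%E by rewrite lee_fin mulr_ge0// powR_ge0.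
  rewrite ge0_integralD//.
  - rewrite leeD2l// ge0_integralZl//; last by move=> z _; exact: riesz_ge0.
    by rewrite [leRHS]EFinM lee_wpmul2l.
  - by move=> z _; rewrite lee_fin w0.
  - exact: mw.
  - by move=> z _; rewrite mule_ge0//; exact: riesz_ge0.
  - exact: emeasurable_funM.
(* The case h = 1 of [key]: the shifted kernel is bounded, so W 1 is finite. *)
have Efin : E \is a fin_num.
  rewrite ge0_fin_numE; last by apply: integral_ge0.
  apply: (le_lt_trans (key 1 ltr01)).
  by rewrite -(fineK (Wfin 1 ltr01)) -EFinD ltry.
exists (fine E), (m.+1%:R * M) => c r1 r2 r12; have /andP[r10 r1r2] := r12.
have r20 := lt_trans r10 r1r2.
pose f r (u : T) : Rn R m.+3 := dilate c r (ch u).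
have mf r : measurable_fun setT (f r) by exact: measurable_dilate.
have [Q1 [Q1E I1]] := probability_image P (mf r1).
have [Q2 [Q2E I2]] := probability_image P (mf r2).
have EQ1 := mutual_energy_image (mf r1) (mf r1) I1 I1.
have EQ2 := mutual_energy_image (mf r2) (mf r2) I2 I2.
have EQ12 := mutual_energy_image (mf r1) (mf r2) I1 I2.
have self r : 0 < r -> (\int[P \x P]_z newton_kernel (f r z.1 : 'rV[R]_m.+3) (f r z.2) =
    ((r ^+ m.+1)^-1)%:E * E)%E.
  move=> r0.
  have p0 : (0 <= ((r ^+ m.+1)^-1)%:E)%E by rewrite lee_fin invr_ge0 exprn_ge0// ltW.
  rewrite -[RHS](@ge0_integralZl _ _ _ (P \x P)%E setT measurableT K mK _ (fun z _ => K0 z) p0).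
  by apply: eq_integral => z _; exact: newton_dilate.
have h0 : 0 < 1 - r1 / r2 by rewrite subr_gt0 ltr_pdivrMr// mul1r.
have cross : (((r2 ^+ m.+1)^-1)%:E * W (1 - r1 / r2)%R <= mutual_energy Q1 Q2)%E.
  have p0 : (0 <= ((r2 ^+ m.+1)^-1)%:E)%E by rewrite lee_fin invr_ge0 exprn_ge0// ltW.
  have wh0 z : (0 <= (w (1 - r1 / r2)%R z)%:E)%E by rewrite lee_fin w0.
  rewrite EQ12 -[leLHS](@ge0_integralZl _ _ _ (P \x P)%E setT measurableT _ (mw _ h0) _
    (fun z _ => wh0 z) p0).
  apply: ge0_le_integral => //.
  - by move=> z _; exact: mule_ge0.
  - by apply: emeasurable_funM => //; exact: mw.
  - by apply: measurable_newton_kernel; exact: (measurableT_comp (mf _)).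
  - move=> z _; rewrite -EFinM; apply: newton_dilate2_ge => //; exact: dist2_chart0.
rewrite -> self in EQ1; last by [].
rewrite -> self in EQ2; last by [].
exists Q1, Q2; split.
- move=> A mA SA; apply: (admissible_image (mf r1) Q1E (ltW r10) _ mA SA) => [u|].
    apply/(sphereE _ _ (ltW r10)); rewrite dist2_dilate_center.
    by rewrite dist2_chart0 mulr1.
  by rewrite EQ1 -(fineK Efin) -EFinM ltry.
- move=> A mA SA; apply: (admissible_image (mf r2) Q2E (ltW r20) _ mA SA) => [u|].
    apply/(sphereE _ _ (ltW r20)); rewrite dist2_dilate_center.
    by rewrite dist2_chart0 mulr1.
  by rewrite EQ2 -(fineK Efin) -EFinM ltry.
rewrite /energy_diff EQ1 EQ2 (mutual_energyC Q2 Q1).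
have := key _ h0; move: cross.
rewrite -(fineK (Wfin _ h0)) -(fineK Efin) -!EFinM.
move: (mutual_energy Q1 Q2) => x; move: (fine (W _)) (fine E) => b a.
set A1 := (r1 ^+ m.+1)^-1; set A2 := (r2 ^+ m.+1)^-1.
rewrite -EFinD lee_fin => xb ab.
apply: (@le_trans _ _ (A1 * a - A2 * b - A2 * b + A2 * a)%:E).
  by rewrite EFinD leeD// EFinB leeB// EFinB leeB.
have A20 : 0 <= A2 by rewrite invr_ge0 exprn_ge0// ltW.
rewrite lee_fin /=; have := ler_wpM2l A20 ab; clearbody A1 A2.
by move: ((1 - r1 / r2) `^ eta) => p; lra.
Qed.

End near_optimal.

(** * Decay of the bound along the sequence of radii *)

Section radii.
Variables (R : realType) (m : nat) (q : R) (r1 r2 : nat -> R).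
Hypotheses (hq : 0 < q)
  (hr1 : forall k : nat, (2 <= k)%N ->
     0 < r1 k /\ (r1 k ^+ m.+1)^-1 = k%:R ^+ 2 + k%:R `^ (- q))
  (hr2 : forall k : nat, (2 <= k)%N ->
     0 < r2 k /\ (r2 k ^+ m.+1)^-1 = k%:R ^+ 2).

Lemma radius_lt k : (2 <= k)%N -> r1 k < r2 k.
Proof.
move=> k2; have [r10 e1] := hr1 k2; have [r20 e2] := hr2 k2.
rewrite -(@ltr_pXn2r _ m.+1) ?nnegrE ?ltW// -ltf_pV2 ?posrE ?exprn_gt0//.
by rewrite e1 e2 ltrDl powR_gt0// ltr0n (leq_trans _ k2).
Qed.

(* With [t = r1 k / r2 k < 1], [t >= t ^ (m + 1) = k ^ 2 / (k ^ 2 + k ^ (- q))]. *)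
Lemma radius_gap k : (2 <= k)%N -> 1 - r1 k / r2 k <= k%:R `^ (- (q + 2)).
Proof.
move=> k2; have [r10 e1] := hr1 k2; have [r20 e2] := hr2 k2.
have k0 : 0 < k%:R :> R by rewrite ltr0n (leq_trans _ k2).
have k20 : 0 < k%:R ^+ 2 :> R by rewrite exprn_gt0.
have p0 : 0 < k%:R `^ (- q) by exact: powR_gt0.
set t := r1 k / r2 k.
have t0 : 0 < t by rewrite divr_gt0.
have t1 : t <= 1 by rewrite ler_pdivrMr// mul1r ltW// radius_lt.
have tE : t ^+ m.+1 = k%:R ^+ 2 / (k%:R ^+ 2 + k%:R `^ (- q)).
  by rewrite -e1 -e2 invrK /t expr_div_n mulrC.
have tt : t ^+ m.+1 <= t by rewrite exprS ler_piMr ?(ltW t0)// exprn_ile1// ltW.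
have -> : k%:R `^ (- (q + 2)) = k%:R `^ (- q) / k%:R ^+ 2.
  rewrite opprD powRD; last by rewrite (gt_eqF k0) implybT.
  by rewrite [in X in _ * X]powRN powR_mulrn// ltW.
apply: (@le_trans _ _ (1 - t ^+ m.+1)); first by rewrite lerD2l lerN2.
have s0 : 0 < k%:R ^+ 2 + k%:R `^ (- q) by rewrite addr_gt0.
rewrite tE (_ : 1 - _ = k%:R `^ (- q) / (k%:R ^+ 2 + k%:R `^ (- q))).
  by rewrite ler_wpM2l ?(ltW p0)// lef_pV2 ?posrE// lerDl ltW.
by field; rewrite gt_eqF.
Qed.

(* Chosen so that [k ^ 2 * (k ^ (- (q + 2))) ^ gap_exponent = k ^ (- (q / 2))]. *)
Definition gap_exponent : R := (2 + q / 2) / (q + 2).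

Lemma gap_exponent_01 : 0 < gap_exponent < 1.
Proof.
have q2 : 0 < q + 2 by rewrite addr_gt0.
have q20 : 0 < 2 + q / 2 by rewrite addr_gt0// divr_gt0.
by rewrite /gap_exponent divr_gt0// ltr_pdivrMr// mul1r; have := hq; lra.
Qed.

(** The difference of the inverse powers is exactly k^(-q), and [gap_exponent] turns the second term
    into a multiple of k^(-q/2); the slower rate serves for both. *)
Lemma near_optimal_bound (e C : R) (k : nat) : (2 <= k)%N ->
  ((r1 k ^+ m.+1)^-1 - (r2 k ^+ m.+1)^-1) * e +
    2 * ((r2 k ^+ m.+1)^-1 * (C * (1 - r1 k / r2 k) `^ gap_exponent))
  <= (`|e| + 2 * `|C|) * k%:R `^ (- (q / 2)).
Proof.
move=> k2; have [r10 e1] := hr1 k2; have [r20 e2] := hr2 k2.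
have k0 : 0 < k%:R :> R by rewrite ltr0n (leq_trans _ k2).
have k1 : 1 <= k%:R :> R by rewrite ler1n (leq_trans _ k2).
have /andP[g0 g1] := gap_exponent_01.
rewrite e1 e2 addrAC subrr add0r.
set h := 1 - _; set p := k%:R `^ (- (q / 2)).
have p0 : 0 <= p by exact: powR_ge0.
have h0 : 0 <= h by rewrite subr_ge0 ler_pdivrMr// mul1r ltW// radius_lt.
have hp : h `^ gap_exponent <= (k%:R ^+ 2)^-1 * p.
  have -> : (k%:R ^+ 2)^-1 * p = (k%:R `^ (- (q + 2))) `^ gap_exponent.
    rewrite -powRrM (_ : - (q + 2) * gap_exponent = - 2 - q / 2); last first.
      by rewrite /gap_exponent; field; rewrite gt_eqF// addr_gt0.
    rewrite powRD; last by rewrite (gt_eqF k0) implybT.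
    by rewrite (_ : k%:R `^ (- 2) = (k%:R ^+ 2)^-1)// powRN powR_mulrn// ltW.
  apply: ge0_ler_powR; rewrite ?nnegrE ?powR_ge0// ?(ltW g0)//.
  exact: radius_gap.
have qp : k%:R `^ (- q) <= p by rewrite ler_powR// lerN2; have := hq; lra.
rewrite [leRHS]mulrDl; apply: lerD.
  apply: (@le_trans _ _ (k%:R `^ (- q) * `|e|)).
    by rewrite ler_wpM2l ?powR_ge0// ler_norm.
  by rewrite mulrC ler_wpM2l.
rewrite -mulrA ler_wpM2l//.
apply: (@le_trans _ _ (k%:R ^+ 2 * (`|C| * ((k%:R ^+ 2)^-1 * p)))).
  rewrite ler_wpM2l ?sqr_ge0//.
  apply: (@le_trans _ _ (`|C| * h `^ gap_exponent)).
    by rewrite ler_wpM2r ?powR_ge0// ler_norm.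
  by rewrite ler_wpM2l.
rewrite le_eqVlt; apply/orP; left; apply/eqP; field.
by rewrite gt_eqF.
Qed.

Lemma small_powR (D eps : R) : 0 <= D -> 0 < eps ->
  exists k, (2 <= k)%N /\ D * k%:R `^ (- (q / 2)) <= eps.
Proof.
move=> D0 eps0.
(* (D / eps)^(2/q) solves D k^(-q/2) = eps over the reals; adding 2 to its integer part exceeds it
   and ensures k >= 2. *)
pose k := (Num.truncn ((D / eps) `^ (2 / q))).+2; exists k; split => //.
have q20 : 0 < q / 2 by rewrite divr_gt0.
have k0 : 0 < k%:R :> R by rewrite ltr0n.
have De : 0 <= D / eps by rewrite divr_ge0// ltW.
rewrite powRN ler_pdivrMr ?powR_gt0// mulrC -ler_pdivrMr//.
have -> : D / eps = ((D / eps) `^ (2 / q)) `^ (q / 2).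
  rewrite -powRrM (_ : 2 / q * (q / 2) = 1) ?powRr1//.
  by field; rewrite gt_eqF.
apply: ge0_ler_powR; rewrite ?nnegrE ?powR_ge0 ?(ltW q20)//.
apply: (le_trans (ltW (truncnS_gt _))).
by rewrite ler_nat.
Qed.

End radii.

Lemma exprz_newton (R : realType) (m : nat) (r : R) :
  r ^ (2%:Z - m.+3%:Z) = (r ^+ m.+1)^-1.
Proof. by rewrite (_ : 2%:Z - m.+3%:Z = - (m.+1%:Z)) ?exprzN//; lia. Qed.

Theorem theorem4p6 (R : realType) (n : nat) (q : R) (r1 r2 : nat -> R)
    (hn : (3 <= n)%N) (hq : 0 < q)
    (hr1 : forall k : nat, (2 <= k)%N ->
       0 < r1 k /\ r1 k ^ (2%:Z - n%:Z) = k%:R ^+ 2 + k%:R `^ (- q))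
    (hr2 : forall k : nat, (2 <= k)%N ->
       0 < r2 k /\ r2 k ^ (2%:Z - n%:Z) = k%:R ^+ 2) :
  let A1 : set 'rV[R]_n := sphere_union r1 in
  let A2 : set 'rV[R]_n := sphere_union r2 in
  let m := ereal_inf [set e : \bar R | exists mu1 mu2 : borel_measure R n,
    [/\ admissible A1 mu1, admissible A2 mu2 & e = energy_diff mu1 mu2]] in
  m = 0%E /\
  ~ (exists mu1 mu2 : borel_measure R n,
       [/\ admissible A1 mu1, admissible A2 mu2 & energy_diff mu1 mu2 = m]).
Proof.
case: n hn hr1 hr2 => [|[|[|m]]]// _ hr1' hr2' A1 A2.
have hr1 k : (2 <= k)%N -> 0 < r1 k /\ (r1 k ^+ m.+1)^-1 = k%:R ^+ 2 + k%:R `^ (- q).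
  by move=> /hr1'; rewrite exprz_newton.
have hr2 k : (2 <= k)%N -> 0 < r2 k /\ (r2 k ^+ m.+1)^-1 = k%:R ^+ 2.
  by move=> /hr2'; rewrite exprz_newton.
have mA r : measurable (sphere_union (n := m.+3) r : set (Rn R m.+3)).
  exact: measurable_sphere_union.
set S := [set e | _].
have inf0 : ereal_inf S = 0%E.
  apply/eqP; rewrite eq_le; apply/andP; split; last first.
    apply: le_ereal_inf_tmp => _ [mu1 [mu2 [ad1 ad2 ->]]].
    have [P muP] := admissible_probability (mA r1) ad1.
    have [Q muQ] := admissible_probability (mA r2) ad2.
    move: ad1 ad2; rewrite muP muQ => -[_ PP _ _] [_ QQ _ _].
    exact: energy_diff_ge0.
  apply/lee_addgt0Pr => eps eps0; rewrite add0e.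
  have [e [C near]] := near_optimal_pair m (gap_exponent_01 hq).
  have D0 : 0 <= `|e| + 2 * `|C| by rewrite addr_ge0// mulr_ge0.
  (* As e and C do not depend on k, a single pair of concentric spheres with large k brings the
     energy difference below eps. *)
  have [k [k2 hk]] := small_powR hq D0 eps0.
  have r12 : 0 < r1 k < r2 k by rewrite (proj1 (hr1 k k2)) (radius_lt hr1 hr2 k2).
  have [Q1 [Q2 [ad1 ad2 en]]] := near (Defs.center R m.+3 k) _ _ r12.
  apply: (@le_trans _ _ (energy_diff Q1 Q2)).
    apply: ereal_inf_lbound; exists Q1, Q2; split => //.
    - by apply: (ad1 _ (mA r1)) => x Sx; exists k.
    - by apply: (ad2 _ (mA r2)) => x Sx; exists k.
  apply: (le_trans en); rewrite lee_fin.
  exact: le_trans (near_optimal_bound hq hr1 hr2 _ _ k2) hk.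
split; first exact: inf0.
move=> [mu1 [mu2 [ad1 ad2]]]; rewrite [in X in _ = X -> _]inf0.
have [P muP] := admissible_probability (mA r1) ad1.
have [Q muQ] := admissible_probability (mA r2) ad2.
rewrite muP muQ in ad1 ad2 *; apply: energy_diff_neq0 ad1 ad2.
- by move=> k /hr1[].
- by move=> k /hr2[].
- by move=> k k2; rewrite lt_eqF// (radius_lt hr1 hr2 k2).
Qed.
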